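(* Suppose that the filters are $\gamma_i^{(t)}=g(t,\lambda_i)$ with a regulariser $g$ satisfying Assumption (R) with $\rho>1$, that $|\kappa-D\delta^2|\le C_\kappa\sqrt D\,\delta^2$ with $C_\kappa\in[0,C_\circ)$, and that $\lambda_i=c_Ai^{-1/\nu}$, $i=1,\dots,D$, for $c_A>0$ and $0<\nu<\min(\rho,2\rho-2)$. Then $$\mathbb{E}\big[\|\widehat\mu^{(\tau)}-\mu\|^2\big]\le C_{\tau,\mathfrak{ws}}\max\Big(\delta^{-4/\nu}\,\mathbb{E}\big[\|\widehat\mu^{(t_{\mathfrak w})}-\mu\|_{\mathsf A}^2\big]^{1+2/\nu},\ \mathbb{E}\big[\|\widehat\mu^{(t_{\mathfrak s})}-\mu\|^2\big]\Big)$$ holds with a constant $C_{\tau,\mathfrak{ws}}$ depending only on $\rho,\beta_-,\beta_+,c_A,C_\circ,C_\kappa$.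
   Context: Fix $D\in\mathbb{N}$, a noise level $\delta>0$, numbers $1\ge\lambda_1\ge\dots\ge\lambda_D>0$ and a signal $\mu\in\mathbb{R}^D$. One observes $Y_i=\lambda_i\mu_i+\delta\varepsilon_i$, $i=1,\dots,D$, with $\varepsilon_i$ independent standard normal. For filters $\gamma_i^{(t)}\in[0,1]$, $t\ge0$, set $\widehat\mu_i^{(t)}=\gamma_i^{(t)}\lambda_i^{-1}Y_i$. Norms: $\|v\|^2=\sum_iv_i^2$, $\|v\|_{\mathsf A}^2=\sum_i\lambda_i^2v_i^2$. Notation (all sums over $i=1,\dots,D$): $R_t^2=\sum_i(1-\gamma_i^{(t)})^2Y_i^2$; $B_t^2(\mu)=\sum_i(1-\gamma_i^{(t)})^2\mu_i^2$; $V_t=\delta^2\sum_i(\gamma_i^{(t)})^2\lambda_i^{-2}$; $B_{t,\lambda}^2(\mu)=\sum_i(1-\gamma_i^{(t)})^2\lambda_i^2\mu_i^2$; $V_{t,\lambda}=\delta^2\sum_i(\gamma_i^{(t)})^2$. Indices: $t_\circ=\inf\{t\ge0:V_{t,\lambda}=C_\circ D^{1/2}\delta^2\}$ for some constant $C_\circ\ge1$ (well defined for $C_\circ<D^{1/2}$); for a threshold $\kappa>0$, $\tau=\inf\{t\ge t_\circ:R_t^2\le\kappa\}$; $t_{\mathfrak w}=t_{\mathfrak w}(\mu)=\inf\{t\ge t_\circ:B_{t,\lambda}^2(\mu)\le V_{t,\lambda}\}$; $t_{\mathfrak s}=t_{\mathfrak s}(\mu)=\inf\{t\ge t_\circ:B_t^2(\mu)\le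 V_t\}$. Assumption (R) on $g:\mathbb{R}_+\times\mathbb{R}_+\to[0,1]$: (R1) $g(t,\lambda)$ is nondecreasing in $t$ and $\lambda$, continuous in $t$ with $g(0,\lambda)=0$ and $\lim_{t\to\infty}g(t,\lambda)=1$ for any fixed $\lambda>0$; (R2) for all $t\ge t'\ge t_\circ$ the function $\lambda\mapsto\frac{1-g(t',\lambda)}{1-g(t,\lambda)}$ is nondecreasing; (R3) there exist positive constants $\rho,\beta_-,\beta_+$ such that for all $t\ge t_\circ$ and $\lambda\in(0,1]$: $\beta_-\min((t\lambda)^\rho,1)\le g(t,\lambda)\le\min(\beta_+(t\lambda)^\rho,1)$.
   Formalization: The constant may also depend on ν; with the listed dependencies only, the claim fails as ν→0 (e.g. D=5, μ=0, δ=c_A=C∘=1, C_κ=0, κ=5, g=min((tλ)²,1), where the left side grows like 5^{2/ν} and the maximum at most like 3^{2/ν}). *)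

(* Defs.v *)
From HB Require Import structures.
From mathcomp Require Import all_boot all_order all_algebra.
From mathcomp Require Import all_classical all_reals all_analysis.

Set Implicit Arguments.
Unset Strict Implicit.
Unset Printing Implicit Defensive.

Import Order.TTheory GRing.Theory Num.Theory.
Import numFieldNormedType.Exports.

Local Open Scope classical_set_scope.
Local Open Scope ring_scope.

(* The coordinate i = 1, ..., D is the ordinal i : 'I_D, shifted by one.
   A filter is a function gamma : R -> 'I_D -> R, with gamma t i the value
   of the i-th filter at time t; only times t >= 0 are ever used. *)

Section SequenceModel.
Context {R : realType} {D : nat}.
Implicit Types (lam mu Y v : 'I_D -> R) (delta kappa Ccirc t : R).
Implicit Types gamma : R -> 'I_D -> R.

Definition spectrum lam : Prop :=
  [/\ forall i, lam i <= 1,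
      forall i j : 'I_D, (i <= j)%N -> lam j <= lam i
    & forall i, 0 < lam i].

Definition observation lam mu delta (e : 'I_D -> R) : 'I_D -> R :=
  fun i => lam i * mu i + delta * e i.

Definition estimator lam gamma Y t : 'I_D -> R :=
  fun i => gamma t i * (lam i)^-1 * Y i.

Definition strong_sqnorm v : R := \sum_i v i ^+ 2.

Definition weak_sqnorm lam v : R := \sum_i lam i ^+ 2 * v i ^+ 2.

Definition residual_sq gamma Y t : R :=
  \sum_i (1 - gamma t i) ^+ 2 * Y i ^+ 2.

Definition strong_bias_sq gamma mu t : R :=
  \sum_i (1 - gamma t i) ^+ 2 * mu i ^+ 2.

Definition strong_variance lam gamma delta t : R :=
  delta ^+ 2 * \sum_i gamma t i ^+ 2 * lam i ^- 2.

Definition weak_bias_sq lam gamma mu t : R :=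
  \sum_i (1 - gamma t i) ^+ 2 * lam i ^+ 2 * mu i ^+ 2.

Definition weak_variance gamma delta t : R :=
  delta ^+ 2 * \sum_i gamma t i ^+ 2.

Definition initial_time gamma delta Ccirc : R :=
  inf [set t | 0 <= t /\
    weak_variance gamma delta t = Ccirc * Num.sqrt D%:R * delta ^+ 2].

Definition stopping_time gamma Y kappa (t0 : R) : R :=
  inf [set t | t0 <= t /\ residual_sq gamma Y t <= kappa].

Definition weak_balanced_time lam gamma mu delta (t0 : R) : R :=
  inf [set t | t0 <= t /\
    weak_bias_sq lam gamma mu t <= weak_variance gamma delta t].

Definition strong_balanced_time lam gamma mu delta (t0 : R) : R :=
  inf [set t | t0 <= t /\
    strong_bias_sq gamma mu t <= strong_variance lam gamma delta t].

End SequenceModel.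

Section Regulariser.
Context {R : realType}.
Implicit Types (g : R -> R -> R) (t l : R).

Definition regulariser_filter g (D : nat) (lam : 'I_D -> R) : R -> 'I_D -> R :=
  fun t i => g t (lam i).

(* The quotient (1 - g(t', l)) / (1 - g(t, l)), read as +oo where the
   denominator vanishes. Regularisers such as g(t, l) = min((t l)^rho, 1) or
   Landweber iteration reach the value 1, whereas x / 0 = 0 in MathComp. *)
Definition residual_ratio g (t' : R) t l : \bar R :=
  if 1 - g t l == 0 then +oo%E else ((1 - g t' l) / (1 - g t l))%:E.

(* Functions on R_+ x R_+ are represented by functions on R x R all of whose
   properties are only required on nonnegative arguments. *)
Record assumption_R g (t0 rho beta_m beta_p : R) : Prop := AssumptionR {
  reg_range : forall t l, 0 <= t -> 0 <= l -> 0 <= g t l <= 1;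
  reg_mono_time : forall t t' l,
    0 <= t -> t <= t' -> 0 <= l -> g t l <= g t' l;
  reg_mono_spectrum : forall t l l',
    0 <= t -> 0 <= l -> l <= l' -> g t l <= g t l';
  reg_continuous : forall l, 0 < l ->
    {within [set t : R | 0 <= t], continuous (fun t => g t l)};
  reg_at0 : forall l, 0 < l -> g 0 l = 0;
  reg_limit : forall l, 0 < l -> (fun t => g t l) @ +oo --> (1 : R);
  reg_ratio : forall t t', t0 <= t' -> t' <= t -> forall l l',
    0 <= l -> l <= l' ->
    (residual_ratio g t' t l <= residual_ratio g t' t l')%E;
  reg_bounds : forall t l, t0 <= t -> 0 < l <= 1 ->
    beta_m * Num.min ((t * l) `^ rho) 1 <= g t l
      <= Num.min (beta_p * (t * l) `^ rho) 1
}.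

End Regulariser.

Section Probability.
Context (d : measure_display) (T : measurableType d) (R : realType) (P : probability T R).

Definition mutually_independent (I : finType) (X : I -> {RV P >-> R}) : Prop :=
  forall (J : {set I}) (A : I -> set R), (forall i, measurable (A i)) ->
    P (\bigcap_(i in [set` J]) (X i @^-1` A i)) =
    (\prod_(i in J) P (X i @^-1` A i))%E.

Definition standard_normal (X : {RV P >-> R}) : Prop :=
  forall A : set R, measurable A -> distribution P X A = normal_prob 0 1 A.

End Probability.

(* Main.v *)
(** Let [N_t = sum_i gamma_i(t)^2] be the effective dimension and let
    [b(t) = B_{t,lambda}^2 / delta^2].  (R3) and the polynomial spectrum give
    [gamma_i(t) <= C (N_t / i)^(rho/nu)].  Hence [V_t] is of order
    [delta^2 N_t^(1+2/nu)], and splitting the indices according to whether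
    [gamma_i(t_s) <= 1/2] yields
    [B_tau^2 <= C N_{t_s}^(2/nu) B_{tau,lambda}^2 + 4 B_{t_s}^2].  As the errors at
    [t_w] and [t_s] are at least of order [delta^2 N_{t_w}] and
    [B_{t_s}^2 + V_{t_s}], it remains to show that [b(tau)] and the stochastic
    error at [tau] are, in expectation, of order [N_{t_w}] and
    [N_{t_w}^(1+2/nu)].

    Since [R_t^2] is nonincreasing in [t], [tau <= t] means [R_t^2 <= kappa]
    for every fixed [t].  The exponential Markov inequality for the Gaussian
    quadratic form [R_t^2], with exponent of order [D^(-1/2)], bounds the
    probabilities of [b(tau) > u] and of [N_tau > u] by [exp(- u / u0)] for
    [u >= u0], where [u0] is a multiple of [N_{t_w} >= D^(1/2)].  Summing over
    the dyadic levels [u0 2^k] gives both expectations. *)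

Require Import Defs.
From HB Require Import structures.
From mathcomp Require Import all_boot all_order all_algebra.
From mathcomp Require Import all_classical all_reals all_analysis.
From mathcomp Require Import measurable_realfun ring lra.

Set Implicit Arguments.
Unset Strict Implicit.
Unset Printing Implicit Defensive.

Import Order.TTheory GRing.Theory Num.Theory.
Import numFieldNormedType.Exports.

Local Open Scope classical_set_scope.
Local Open Scope ring_scope.

(** * Monotonicity of integrals and change of measure *)

Section ChangeOfMeasure.
Local Open Scope ereal_scope.
Context (R : realType).

(* The stopped losses are not assumed measurable in the sample point; the
   integral of a nonnegative function is a supremum over the simple functions
   below it, hence monotone without measurability. *)
Lemma ge0_le_integral_nonmeasurable d (T : measurableType d)
    (mu : {measure set T -> \bar R}) (f g : T -> \bar R) :
  (forall x, 0 <= f x) -> (forall x, f x <= g x) ->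
  \int[mu]_x f x <= \int[mu]_x g x.
Proof.
move=> f0 fg; rewrite !ge0_integralTE//; last first.
  by move=> x; exact: le_trans (f0 x) (fg x).
apply: ereal_sup_le => _ [h hf <-]; exists h => // x.
exact: le_trans (hf x) (fg x).
Qed.

Import HBNNSimple.

(** The hypothesis on indicators extends to simple functions by linearity and to nonnegative [f] by
    monotone convergence. The weight [h] is used once as a Gaussian density and once as the product
    of the remaining factors of an independent family. *)
Lemma integral_change_of_measure d (T : measurableType d)
    (mu : {measure set T -> \bar R}) (X : T -> R) (h : T -> R)
    (m : {measure set R -> \bar R}) (c : R) :
  measurable_fun setT X -> measurable_fun setT h ->
  (forall w, (0 <= h w)%R) -> (0 <= c)%R ->
  (forall A, measurable A ->
     \int[mu]_w (\1_A (X w) * h w)%:E = c%:E * m A) ->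
  forall f : R -> R, measurable_fun setT f -> (forall x, (0 <= f x)%R) ->
  \int[mu]_w (f (X w) * h w)%:E = c%:E * \int[m]_x (f x)%:E.
Proof.
move=> mX mh h0 c0 hA f mf f0.
have mEf : measurable_fun setT (fun x => (f x)%:E) by exact/measurable_EFinP.
pose g := nnsfun_approx measurableT mEf.
have gf x : (g n x)%:E @[n --> \oo] --> (f x)%:E.
  by apply: cvg_nnsfun_approx => // y _; rewrite lee_fin.
have mg n : measurable_fun setT (g n) by exact: measurable_funP.
have gnd x : {homo (fun n => (g n x)%:E) : a b / (a <= b)%N >-> a <= b}.
  by move=> a b ab; rewrite lee_fin; exact/lefP/nd_nnsfun_approx.
have fint : c%:E * \int[m]_x (g n x)%:E @[n --> \oo] --> c%:E * \int[m]_x (f x)%:E.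
  apply: cvgeZl => //.
  have -> : \int[m]_x (f x)%:E = \int[m]_x limn (fun n => (g n x)%:E).
    by apply: eq_integral => x _; apply/esym/cvg_lim => //; exact: gf.
  apply: cvg_monotone_convergence => //.
  - by move=> n; exact/measurable_EFinP.
  - by move=> n x _; rewrite lee_fin.
have -> : \int[mu]_w (f (X w) * h w)%:E =
    limn (fun n => \int[mu]_w (g n (X w) * h w)%:E).
  rewrite -monotone_convergence//.
  - apply: eq_integral => w _; apply/esym/cvg_lim => //.
    under eq_fun do rewrite EFinM.
    by rewrite EFinM; apply: cvgeZr => //; exact: gf.
  - move=> n; apply/measurable_EFinP/measurable_funM => //.
    exact: measurableT_comp.
  - by move=> n w _; rewrite lee_fin mulr_ge0.
  - move=> w _ a b ab; rewrite !EFinM lee_wpmul2r ?lee_fin//.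
    exact: gnd.
have step n : \int[mu]_w (g n (X w) * h w)%:E = c%:E * \int[m]_x (g n x)%:E.
  have gE x : g n x =
      (\sum_(y <- finmap.enum_fset (fset_set (range (g n)))) (y * \1_(g n @^-1` [set y]) x))%R.
    by rewrite fimfunE fsbig_finite.
  have mA y : measurable (g n @^-1` [set y]) by exact: measurable_funPTI.
  have m1 y : measurable_fun setT (fun x => (y * \1_(g n @^-1` [set y]) x)%R : R).
    by apply: measurable_funM => //; exact: measurable_indic.
  have y0 y x : (0 <= y * \1_(g n @^-1` [set y]) x :> R)%R.
    rewrite -lee_fin; exact: nnfun_muleindic_ge0.
  under [in LHS]eq_integral => w _.
    rewrite gE mulr_suml -sumEFin; over.
  under [in RHS]eq_integral => w _.
    rewrite gE -sumEFin; over.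
  rewrite ge0_integral_sum//; last 2 first.
  - move=> y; apply/measurable_EFinP/measurable_funM => //.
    exact: measurableT_comp (m1 y) mX.
  - by move=> y x _; rewrite lee_fin mulr_ge0.
  rewrite ge0_integral_sum//; last 2 first.
  - by move=> y; apply/measurable_EFinP.
  - by move=> y x _; rewrite lee_fin.
  rewrite ge0_sume_distrr; last first.
    by move=> y _; apply: integral_ge0 => x _; rewrite lee_fin.
  apply: eq_bigr => y _.
  (* A nonnegative simple function takes no negative value, so both sides vanish for [y < 0];
     otherwise the scalar [y] can be pulled out of the integrals. *)
  have [ylt0|yge0] := ltP y 0%R.
    have -> : g n @^-1` [set y] = set0.
      rewrite -subset0 => x /= gxy; move: ylt0; rewrite -gxy ltNge.
      by rewrite fun_ge0.
    rewrite !integral0_eq ?mule0// => x _; by rewrite indic0 mulr0 ?mul0r.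
  under eq_integral do rewrite -mulrA EFinM.
  rewrite ge0_integralZl//; last 2 first.
  - apply/measurable_EFinP/measurable_funM => //.
    apply: measurableT_comp => //; exact: measurable_indic.
  - by move=> x _; rewrite lee_fin mulr_ge0.
  rewrite hA//.
  under [in RHS]eq_integral do rewrite EFinM.
  rewrite ge0_integralZl ?lee_fin//; last exact/measurable_EFinP/measurable_indic.
  by rewrite integral_indic// setIT muleCA.
by under eq_fun do rewrite step; apply/cvg_lim.
Qed.
End ChangeOfMeasure.

(** * Exponential moments of a squared Gaussian variable *)

Section StandardNormal.
Context d (T : measurableType d) (R : realType) (P : probability T R).
Variables (X : {RV P >-> R}) (X_normal : standard_normal X).

Lemma integral_standard_normal (f : R -> R) :
  measurable_fun setT f -> (forall x, 0 <= f x) ->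
  (\int[P]_w (f (X w))%:E =
   \int[lebesgue_measure]_x (f x * normal_pdf 0 1 x)%:E)%E.
Proof.
move=> mf f0.
transitivity (\int[distribution P X]_x (f x)%:E)%E.
  by rewrite ge0_integral_distribution//; exact/measurable_EFinP.
rewrite -[LHS]mul1e; apply/esym.
apply: (@integral_change_of_measure R _ _ lebesgue_measure idfun
  (normal_pdf 0 1) (distribution P X) 1) => //.
- by move=> _ A mA; rewrite setTI.
- exact: (measurable_normal_pdf 0 1).
- by move=> w; exact: normal_pdf_ge0.
move=> A mA; rewrite mul1e; transitivity (normal_prob 0 1 A : \bar R); last first.
  exact/esym/X_normal.
rewrite /normal_prob [in RHS]integral_mkcond.
apply: eq_integral => x _; rewrite patchE indicE.
by case: ifP => _; rewrite ?mul1r ?mul0r.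
Qed.

(** Completing the square: the integrand times the [N(0, 1)] density is a constant times the normal
    density with mean [m] and standard deviation [s]; that constant is the right-hand side. *)
Lemma integral_expR_sqr_standard_normal (a x : R) : - 2^-1 < x ->
  (\int[P]_w (expR (- x * (a + X w) ^+ 2))%:E =
   (expR (- x * a ^+ 2 / (1 + 2 * x)) / Num.sqrt (1 + 2 * x))%:E)%E.
Proof.
move=> hx; have r0 : 0 < 1 + 2 * x by lra.
rewrite (@integral_standard_normal (fun y => expR (- x * (a + y) ^+ 2)));
  last 2 first.
- apply: measurableT_comp => //; apply: measurable_funM => //.
  by apply: measurable_funX; exact: measurable_funD.
- by move=> y; exact: expR_ge0.
pose s := (Num.sqrt (1 + 2 * x))^-1; pose m := - (2 * x * a) / (1 + 2 * x).
have sq0 : 0 < Num.sqrt (1 + 2 * x) by rewrite sqrtr_gt0.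
have s0 : 0 < s by rewrite invr_gt0.
have s2 : s ^+ 2 = (1 + 2 * x)^-1 by rewrite exprVn sqr_sqrtr// ltW.
pose K := expR (- x * a ^+ 2 / (1 + 2 * x)) / Num.sqrt (1 + 2 * x).
have K0 : (0 <= K%:E)%E by rewrite lee_fin divr_ge0 ?expR_ge0 ?sqrtr_ge0.
transitivity (K%:E * \int[lebesgue_measure]_y (normal_pdf m s y)%:E)%E; last first.
  by rewrite integral_normal_pdf mule1.
have mpdf := measurable_int _ (integrable_normal_pdf m s).
have pdf0 y : setT y -> (0 <= (normal_pdf m s y)%:E)%E.
  by rewrite lee_fin normal_pdf_ge0.
rewrite -(ge0_integralZl lebesgue_measure measurableT mpdf pdf0 K0).
rewrite /K; clear K0 K.
apply: eq_integral => y _; rewrite -EFinM; congr EFin.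
have -> : normal_pdf m s y = normal_peak s * normal_fun m s y.
  by rewrite normal_pdfE ?gt_eqF.
have -> : normal_pdf 0 1 y = normal_peak 1 * normal_fun 0 1 y.
  by rewrite normal_pdfE ?oner_eq0.
have -> : normal_peak s = Num.sqrt (1 + 2 * x) * normal_peak 1.
  rewrite /normal_peak s2 expr1n mul1r -mulrnAr sqrtrM ?invr_ge0 ?ltW//.
  by rewrite invfM sqrtrV ?invrK// ltW.
have cancelA (A B E1 E2 : R) : 0 < A -> E1 / A * (A * B * E2) = B * (E1 * E2).
  by move=> A0; field; rewrite gt_eqF.
rewrite /normal_fun s2 expr1n mulrCA cancelA// -!expRD; congr (_ * expR _).
rewrite /m; field.
by rewrite gt_eqF.
Qed.
End StandardNormal.

(** * Integrals of products of independent factors *)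

Section Independence.
Context d (T : measurableType d) (R : realType) (P : probability T R).
Context (I : finType) (X : I -> {RV P >-> R}).
Hypothesis X_indep : mutually_independent X.

(** The factors are released from being indicators one index at a time: [s] lists the indices whose
    factor is arbitrary. With [s] empty the claim is independence itself; the induction step is
    [integral_change_of_measure] along [X j], with the other factors as weight. *)
Lemma independent_integral_prod (F : I -> R -> R) (k : I -> R) :
  (forall i, measurable_fun setT (F i)) -> (forall i x, 0 <= F i x) ->
  (forall i, \int[P]_w (F i (X i w))%:E = (k i)%:E)%E ->
  (\int[P]_w (\prod_i F i (X i w))%:E = (\prod_i k i)%:E)%E.
Proof.
suff H (s : seq I) : forall (F : I -> R -> R) (k : I -> R),
    (forall i, measurable_fun setT (F i)) -> (forall i x, 0 <= F i x) ->
    (forall i, \int[P]_w (F i (X i w))%:E = (k i)%:E)%E ->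
    (forall i, i \notin s -> exists2 A, measurable A & F i = \1_A) ->
    (\int[P]_w (\prod_i F i (X i w))%:E = (\prod_i k i)%:E)%E.
  move=> mF F0 Fk; apply: (H (enum I)) => // i; by rewrite mem_enum.
elim: s => [|j s IHs] {}F {}k mF F0 Fk Fs.
  have [A [mA FA]] : exists A : I -> set R,
      (forall i, measurable (A i)) /\ (forall i, F i = \1_(A i)).
    have /choice[A hA] : forall i, exists A : set R, measurable A /\ F i = \1_A.
      by move=> i; have [//|A ? ?] := Fs i; exists A.
    by exists A; split => i; have [] := hA i.
  have kE i : (k i)%:E = P (X i @^-1` A i).
    rewrite -Fk FA; transitivity (\int[P]_w (\1_(X i @^-1` A i) w)%:E)%E.
      by apply: eq_integral => w _; rewrite !indicE.
    by rewrite integral_indic ?setIT//; exact: measurable_funPTI.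
  rewrite -prodEFin; under [RHS]eq_bigr do rewrite kE.
  have hX := X_indep [set: I]%SET mA.
  transitivity (P (\bigcap_i (X i @^-1` A i))); last first.
    have -> : \bigcap_i (X i @^-1` A i) =
        \bigcap_(i in [set` [set: I]%SET]) (X i @^-1` A i).
      by apply: eq_bigcapl; split => i //= _; rewrite inE.
    by rewrite hX; apply: eq_bigl => i; rewrite inE.
  have mAll : measurable (\bigcap_i (X i @^-1` A i)).
    by apply: fin_bigcap_measurable => // i _; exact: measurable_funPTI.
  transitivity (\int[P]_w (\1_(\bigcap_i (X i @^-1` A i)) w)%:E)%E; last first.
    by rewrite integral_indic ?setIT.
  apply: eq_integral => w _; rewrite indicE; congr EFin.
  under eq_bigr do rewrite FA indicE.
  have [wA|wA] := boolP (w \in _).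
    rewrite big1// => i _; rewrite mem_set//.
    by move: wA; rewrite inE => /(_ i Logic.I).
  have [i Ai] : exists i, ~ A i (X i w).
    by apply/existsNP => wAll; move: wA; rewrite notin_setE; apply => i _; exact: wAll.
  by rewrite (bigD1 i)//= memNset ?mul0r.
have [js|js] := boolP (j \in s).
  apply: IHs => // i ns; apply: Fs; rewrite inE negb_or ns andbT.
  by apply: contraNneq ns => ->.
have k0 i : 0 <= k i.
  by rewrite -lee_fin -Fk; apply: integral_ge0 => w _; rewrite lee_fin.
pose h w := \prod_(i | i != j) F i (X i w).
transitivity (\int[P]_w (F j (X j w) * h w)%:E)%E.
  by apply: eq_integral => w _; rewrite (bigD1 j).
rewrite (@integral_change_of_measure R _ _ P (X j) h (distribution P (X j))
  (\prod_(i | i != j) k i))//.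
- rewrite ge0_integral_distribution//.
    by rewrite [X in (_ * X)%E]Fk -EFinM [in RHS](bigD1 j)//= mulrC.
    exact/measurable_EFinP.
  by move=> y; rewrite lee_fin.
- have -> : h = fun w => \prod_(i <- [seq i <- index_enum I | i != j]) F i (X i w).
    by apply/funext => w; rewrite big_filter.
  by apply: measurable_prod => i _; exact: measurableT_comp.
- by move=> w; apply: prodr_ge0.
- by apply: prodr_ge0.
move=> A mA.
(* The indicator identity required for [X j] is the induction hypothesis for the family with [\1_A]
   in place of [F j]. *)
pose F' i := if i == j then \1_A : R -> R else F i.
pose k' i := if i == j then fine (P (X j @^-1` A)) else k i.
have eqF' i : i != j -> F' i = F i by rewrite /F' => /negbTE ->.
have eqk' i : i != j -> k' i = k i by rewrite /k' => /negbTE ->.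
have PA : P (X j @^-1` A) = (fine (P (X j @^-1` A)))%:E.
  by rewrite fineK// fin_num_measure//; exact: measurable_funPTI.
transitivity (\int[P]_w (\prod_i F' i (X i w))%:E)%E.
  apply: eq_integral => w _; rewrite [in RHS](bigD1 j)//= {1}/F' eqxx /h.
  by congr (_ * _)%:E; apply: eq_bigr => i ij; rewrite eqF'.
rewrite (IHs F' k').
- rewrite (bigD1 j)//= {1}/k' eqxx mulrC EFinM -PA; congr (_%:E * _)%E.
  by apply: eq_bigr => i ij; rewrite eqk'.
- move=> i; rewrite /F'; case: ifP => // _; exact: measurable_indic.
- by move=> i x; rewrite /F'; case: ifP => // _; rewrite indicE.
- move=> i; rewrite /F' /k'; case: eqP => [->|_]; last exact: Fk.
  rewrite -PA; transitivity (\int[P]_w (\1_(X j @^-1` A) w)%:E)%E.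
    by apply: eq_integral => w _; rewrite !indicE.
  by rewrite integral_indic ?setIT//; exact: measurable_funPTI.
- move=> i si; rewrite /F'; case: eqP => [_|/eqP ij]; first by exists A.
  by apply: Fs; rewrite inE negb_or ij.
Qed.
End Independence.

(** Controls Gaussian normalising factors to second order. Squared and inverted, it reads
    [exp(y - 2 y^2) <= 1 + y], which follows from [exp(2 y^2 - y) >= 1 + 2 y^2 - y] and [(1 + y) (1
    - y + 2 y^2) = 1 + y^2 (1 + 2 y) >= 1]. *)
Lemma invr_sqrt1D_le_expR (R : realType) (y : R) : - 2^-1 <= y ->
  (Num.sqrt (1 + y))^-1 <= expR (- (y / 2) + y ^+ 2).
Proof.
move=> hy; have y1 : 0 < 1 + y by lra.
have q0 : 0 < 1 + (2 * y ^+ 2 - y) by nra.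
have le1 : expR (y - 2 * y ^+ 2) <= 1 + y.
  rewrite -opprB expRN -[leRHS]invrK lef_pV2 ?posrE ?expR_gt0 ?invr_gt0//.
  apply: le_trans (expR_ge1Dx _).
  rewrite -[_^-1]mul1r ler_pdivrMr//; nra.
rewrite -[leRHS]invrK lef_pV2 ?posrE ?sqrtr_gt0 ?invr_gt0 ?expR_gt0//.
rewrite -expRN -(@ler_pXn2r _ 2) ?nnegrE ?sqrtr_ge0 ?expR_ge0//.
rewrite sqr_sqrtr ?(ltW y1)// -expRM_natl; apply: le_trans le1.
by rewrite ler_expR; lra.
Qed.

(** * Moment bounds for one Gaussian variable *)

Section GaussianBounds.
Context d (T : measurableType d) (R : realType) (P : probability T R).
Local Open Scope ereal_scope.

(** From [y^2 <= 32 exp(y / 4)] with [y = X^2]; the expectation of [exp(X^2 / 4)] is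
    [sqrt 2 <= 2]. *)
Lemma standard_normal_fourth_moment (X : {RV P >-> R}) : standard_normal X ->
  \int[P]_w ((X w ^+ 2) ^+ 2)%:E <= 64%:E.
Proof.
move=> nX.
have mE : measurable_fun setT (fun w => (expR (- (- 4^-1) * (0 + X w) ^+ 2))%:E).
  apply/measurable_EFinP/measurableT_comp => //; apply: measurable_funM => //.
  by apply: measurable_funX; exact: measurable_funD.
apply: (@le_trans _ _
    (32%:E * \int[P]_w (expR (- (- 4^-1) * (0 + X w) ^+ 2))%:E)).
  rewrite -ge0_integralZl//.
  apply: ge0_le_integral_nonmeasurable => w; first by rewrite lee_fin sqr_ge0.
  rewrite -EFinM lee_fin opprK add0r.
  have := @expR_ge1Dxn R (4^-1 * X w ^+ 2)%R 1; rewrite mulr_ge0 ?sqr_ge0//.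
  move=> /(_ isT); rewrite (_ : 2`!%:R = 2 :> R)%R//.
  set y := (X w ^+ 2)%R; set e := expR _; move: e => e; lra.
rewrite integral_expR_sqr_standard_normal//; last by lra.
rewrite -EFinM lee_fin expr0n/= mulr0 mul0r expR0.
have : (2^-1 <= Num.sqrt (1 + 2 * - 4^-1) :> R)%R.
  by rewrite -[leLHS]ger0_norm// -sqrtr_sqr ler_sqrt; lra.
move=> h; rewrite mul1r (le_trans (_ : _ <= 32 * 2)%R)//; last by lra.
rewrite ler_pM2l// -[leRHS]invrK lef_pV2 ?posrE//.
exact: lt_le_trans h.
Qed.

(* From [y >= n (1 - exp(- y / n))] with [y = (b + v X)^2], [n = b^2 + v^2]. *)
Lemma standard_normal_second_moment_ge (X : {RV P >-> R}) (b v : R) :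
  standard_normal X ->
  ((b ^+ 2 + v ^+ 2) / 8)%:E <= \int[P]_w ((b + v * X w) ^+ 2)%:E.
Proof.
move=> nX; set n := (_ + _)%R.
have m2 : measurable_fun setT (fun w => (b + v * X w) ^+ 2)%R.
  apply: measurable_funX; apply: measurable_funD => //.
  exact: measurable_funM.
have [v0|v0] := eqVneq v 0%R.
  rewrite (_ : \int[P]_w _ = (b ^+ 2)%:E).
    by rewrite lee_fin /n v0; have := sqr_ge0 b; lra.
  transitivity (\int[P]_w (cst (b ^+ 2)%:E w)).
    by apply: eq_integral => w _; rewrite v0 mul0r addr0.
  by rewrite integral_cst//= probability_setT mule1.
have n0 : (0 < n)%R by rewrite /n ltr_wpDl ?sqr_ge0 ?exprn_even_gt0.
pose q := (v ^+ 2 / n)%R.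
have /andP[q0 q1] : (0 <= q <= 1)%R.
  by rewrite divr_ge0 ?sqr_ge0 ?(ltW n0)//= ler_pdivrMr// mul1r lerDr sqr_ge0.
pose f w := expR (- q * (b / v + X w) ^+ 2).
have mf : measurable_fun setT (fun w => (f w)%:E).
  apply/measurable_EFinP/measurableT_comp => //; apply: measurable_funM => //.
  by apply: measurable_funX; exact: measurable_funD.
(* The integral is [exp(- (1 - q) / (1 + 2 q)) / sqrt(1 + 2 q)]. For [q >= 1/2] the square root is
   at least [8/7]; for [q < 1/2] the exponential is at most [exp(- 1/4) <= 4/5]. *)
have fint : \int[P]_w (f w)%:E <= (7 / 8)%:E.
  rewrite integral_expR_sqr_standard_normal//; last by lra.
  have e1 : (- q * (b / v) ^+ 2 = - (1 - q))%R.
    rewrite /q /n; field; rewrite v0 andbT; apply: lt0r_neq0 n0.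
  rewrite lee_fin e1; have s1 : (1 <= Num.sqrt (1 + 2 * q))%R.
    by rewrite -[leLHS]sqrtr1 ler_sqrt; lra.
  have [q2|q2] := lerP 2^-1 q.
    rewrite ler_pdivrMr ?(lt_le_trans _ s1)//.
    have : (8 / 7 <= Num.sqrt (1 + 2 * q))%R.
      by rewrite -[leLHS]ger0_norm// -sqrtr_sqr ler_sqrt; lra.
    have : (expR (- (1 - q) / (1 + 2 * q)) <= 1)%R.
      rewrite -[leRHS]expR0 ler_expR ler_pdivrMr; lra.
    lra.
  have : (expR (- (1 - q) / (1 + 2 * q)) <= 4 / 5)%R.
    apply: (@le_trans _ _ (expR (- 4^-1))).
      rewrite ler_expR ler_pdivrMr; lra.
    have e5 : (5 / 4 <= expR (4^-1 : R))%R.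
      by apply: le_trans (expR_ge1Dx _); lra.
    rewrite expRN -[(4 / 5)%R]invf_div lef_pV2 ?posrE ?expR_gt0//.
  move=> h; rewrite ler_pdivrMr ?(lt_le_trans _ s1)//; lra.
have : n%:E <= \int[P]_w ((b + v * X w) ^+ 2)%:E + n%:E * \int[P]_w (f w)%:E.
  rewrite -ge0_integralZl ?lee_fin ?(ltW n0)//; last first.
    by move=> w _; rewrite lee_fin expR_ge0.
  rewrite -ge0_integralD//; last 4 first.
  - by move=> w _; rewrite lee_fin sqr_ge0.
  - exact/measurable_EFinP.
  - by move=> w _; rewrite -EFinM lee_fin mulr_ge0 ?expR_ge0 ?ltW.
  - exact: measurable_funeM.
  rewrite [leLHS](_ : _ = \int[P]_w (cst n%:E w)); last first.
    by rewrite integral_cst//= probability_setT mule1.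
  apply: ge0_le_integral_nonmeasurable => w; first by rewrite lee_fin ltW.
  rewrite /cst -EFinM -EFinD lee_fin.
  have -> : ((b + v * X w) ^+ 2 = n * (q * (b / v + X w) ^+ 2))%R.
    by rewrite /q; field; rewrite v0 gt_eqF.
  have := @expR_ge1Dx R (- q * (b / v + X w) ^+ 2).
  rewrite mulNr -/(f w); set z := (q * _)%R => hz.
  by rewrite -[leLHS]mulr1 -mulrDr ler_pM2l// /f mulNr -/z; lra.
move=> h.
have {h} : n%:E <= \int[P]_w ((b + v * X w) ^+ 2)%:E + (n * (7 / 8))%:E.
  apply: le_trans h _; rewrite leeD2l// EFinM lee_wpmul2l// lee_fin ltW//.
by rewrite -leeBlDr//; apply: le_trans; rewrite -EFinB lee_fin; lra.
Qed.

End GaussianBounds.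

(** * Exponential moments of Gaussian quadratic forms *)

Section QuadraticForm.
Context d (T : measurableType d) (R : realType) (P : probability T R).
Context (D : nat) (X : 'I_D -> {RV P >-> R}).
Hypothesis X_indep : mutually_independent X.
Hypothesis X_normal : forall i, standard_normal (X i).
Variables (a v : 'I_D -> R).
Hypothesis v01 : forall i, 0 <= v i <= 1.

Let quad w : R := \sum_i v i * (a i + X i w) ^+ 2.

Lemma measurable_quadratic_form (s c : R) :
  measurable_fun setT (fun w => expR (s * quad w + c)).
Proof.
apply: measurableT_comp => //; apply: measurable_funD => //.
apply: measurable_funM => //; apply: measurable_sum => i.
by apply: measurable_funM => //; apply: measurable_funX; exact: measurable_funD.
Qed.

(** By independence the integral factorises. The normalising constants are bounded by
    [invr_sqrt1D_le_expR] at [2 * (s * v i)], which [s >= - 4^-1] keeps above [- 2^-1]; their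
    second-order terms, each at most [4 * s ^+ 2], add up to [4 * s ^+ 2 * D]. *)
Lemma integral_expR_quadratic_form (s : R) : - 4^-1 <= s <= 1 ->
  (\int[P]_w (expR (- s * quad w))%:E <=
   (expR (- s * (\sum_i v i) + 4 * s ^+ 2 * D%:R
          - \sum_i s * v i * a i ^+ 2 / (1 + 2 * (s * v i))))%:E)%E.
Proof.
move=> /andP[s4 s1].
have sv i : - 4^-1 <= s * v i.
  have /andP[v0 v1] := v01 i; have [s0|s0] := leP 0 s.
    by have := mulr_ge0 s0 v0; lra.
  have : s * v i >= s * 1 by rewrite ler_nM2l.
  lra.
pose F i y := expR (- (s * v i) * (a i + y) ^+ 2).
pose k i := expR (- (s * v i) * a i ^+ 2 / (1 + 2 * (s * v i))) /
            Num.sqrt (1 + 2 * (s * v i)).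
have -> : (\int[P]_w (expR (- s * quad w))%:E =
           \int[P]_w (\prod_i F i (X i w))%:E)%E.
  apply: eq_integral => w _; rewrite -expR_sum mulr_sumr.
  by congr (expR _)%:E; apply: eq_bigr => i _; rewrite mulrA mulNr.
rewrite (@independent_integral_prod _ _ _ _ _ _ X_indep F k); last 3 first.
- move=> i; apply: measurableT_comp => //; apply: measurable_funM => //.
  by apply: measurable_funX; exact: measurable_funD.
- by move=> i x; exact: expR_ge0.
- move=> i; rewrite integral_expR_sqr_standard_normal//.
  by have := sv i; lra.
rewrite lee_fin.
apply: (@le_trans _ _ (\prod_i expR (- (s * v i) + 4 * s ^+ 2
          - s * v i * a i ^+ 2 / (1 + 2 * (s * v i))))).
  apply: ler_prod => i _; rewrite /k divr_ge0 ?expR_ge0 ?sqrtr_ge0//=.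
  have /invr_sqrt1D_le_expR h : - 2^-1 <= 2 * (s * v i) by have := sv i; lra.
  rewrite [leRHS]expRD mulrC -!mulNr.
  apply: ler_pM; rewrite ?expR_ge0 ?invr_ge0 ?sqrtr_ge0//.
  apply: le_trans h _; rewrite ler_expR.
  have /andP[v0 v1] := v01 i.
  have : (s * v i) ^+ 2 <= s ^+ 2.
    by rewrite exprMn ler_piMr ?sqr_ge0// expr_le1.
  have -> : (2 * (s * v i)) ^+ 2 = 4 * (s * v i) ^+ 2 by ring.
  lra.
rewrite -expR_sum ler_expR sumrB big_split/= sumrN -mulr_sumr mulNr.
by rewrite sumr_const card_ord -[X in _ + X - _]mulr_natr.
Qed.

(** Controls the lower tail of the form: here [1 + 2 * (s * v i) <= 3], whence the factor [s / 3] on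
    the shift. *)
Lemma integral_expR_quadratic_form_le (s : R) : 0 <= s <= 1 ->
  (\int[P]_w (expR (- s * quad w))%:E <=
   (expR (- s * (\sum_i v i) + 4 * s ^+ 2 * D%:R
          - s / 3 * \sum_i v i * a i ^+ 2))%:E)%E.
Proof.
move=> /andP[s0 s1]; apply: le_trans (integral_expR_quadratic_form _) _.
  by rewrite s1 andbT; lra.
rewrite lee_fin ler_expR lerD2l lerN2 mulr_sumr; apply: ler_sum => i _.
have /andP[v0 v1] := v01 i.
have sv0 : 0 <= s * v i by rewrite mulr_ge0.
have sv1 : s * v i <= 1 by rewrite mulr_ile1.
have -> : s / 3 * (v i * a i ^+ 2) = s * v i * a i ^+ 2 / 3 by ring.
apply: ler_wpM2l; first by rewrite mulr_ge0 ?sqr_ge0.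
rewrite lef_pV2 ?posrE; lra.
Qed.

(** Controls the upper tail: with the sign of [s] reversed, the denominators are
    [1 - 2 * (s * v i) >= 2^-1]. *)
Lemma integral_expR_quadratic_form_ge (s : R) : 0 <= s <= 4^-1 ->
  (\int[P]_w (expR (s * quad w))%:E <=
   (expR (s * (\sum_i v i) + 4 * s ^+ 2 * D%:R
          + 2 * s * \sum_i v i * a i ^+ 2))%:E)%E.
Proof.
move=> /andP[s0 s4].
have := @integral_expR_quadratic_form (- s); rewrite opprK sqrrN.
move=> /(_ _)/le_trans; apply; first by rewrite lerN2 s4/=; lra.
rewrite lee_fin ler_expR lerD2l -sumrN mulr_sumr; apply: ler_sum => i _.
have /andP[v0 v1] := v01 i.
have sv0 : 0 <= s * v i by rewrite mulr_ge0.
have sv1 : s * v i <= 4^-1 by rewrite -[leRHS]mulr1 ler_pM.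
have -> : 2 * s * (v i * a i ^+ 2) = s * v i * a i ^+ 2 * 2 by ring.
rewrite !mulNr opprK; apply: ler_wpM2l; first by rewrite mulr_ge0 ?sqr_ge0.
rewrite -[leRHS]invrK lef_pV2 ?posrE; lra.
Qed.
End QuadraticForm.

(** * Expectations from exponential tails, by dyadic layers *)

Section DyadicLayers.
Context (R : realType).

(** The logarithm [r * ln y - y / 2] of the left side is largest at [y = 2 * r]. The bound
    [ln z <= z - 1] at [z = y / (2 * r)] gives the claim, with a spare factor [exp(- r)]. *)
Lemma powR_expR_le (r y : R) : 0 < r -> 0 < y ->
  y `^ r * expR (- (y / 2)) <= (2 * r) `^ r.
Proof.
move=> r0 y0; have r20 : 0 < 2 * r by lra.
rewrite /powR !gt_eqF// -expRD ler_expR.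
have : ln (1 + (y / (2 * r) - 1)) <= y / (2 * r) - 1.
  by apply: le_ln1Dx; rewrite ltrBrDl addrN divr_gt0.
rewrite addrCA addrN addr0 ln_div ?posrE// => h.
have : r * (ln y - ln (2 * r)) <= r * (y / (2 * r) - 1) by rewrite ler_pM2l.
have -> : r * (y / (2 * r) - 1) = y / 2 - r by field; rewrite gt_eqF.
lra.
Qed.

(* Square root of the tail bound at the level below [u0 2^k], which balances
   [le_half_sqr_invr]. *)
Definition layer_rate (k : nat) : R :=
  if k is k'.+1 then expR (- (2 ^+ k' / 2)) else 1.

Lemma layer_rate_gt0 k : 0 < layer_rate k.
Proof. by case: k => [|k]; rewrite ?ltr01 ?expR_gt0. Qed.

Lemma sum_half_le (m : nat) : \sum_(k < m) 2^-1 ^+ k <= 2 :> R.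
Proof.
suff -> : \sum_(k < m) 2^-1 ^+ k = 2 - 2 * 2^-1 ^+ m :> R.
  by rewrite lerBlDr lerDl mulr_ge0// exprn_ge0.
elim: m => [|m IH]; first by rewrite big_ord0 expr0; lra.
by rewrite big_ord_recr/= IH exprS; lra.
Qed.

(** At index [k + 1] one spare factor [2^k] is inserted: [(2^k)^(q + 1) * exp(- 2^k / 2)] is bounded
    by [powR_expR_le], and the compensating [2^-k] sums to at most 2. *)
Lemma sum_layer_rate_le (q : R) (m : nat) : 0 <= q ->
  \sum_(k < m.+1) layer_rate k * (2 ^+ k) `^ q <=
  1 + 2 `^ q * (2 * (q + 1)) `^ (q + 1) * 2.
Proof.
move=> q0; rewrite big_ord_recl/= expr0 powR1 mulr1 lerD2l.
apply: (@le_trans _ _ (\sum_(k < m)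
    2 `^ q * (2 * (q + 1)) `^ (q + 1) * 2^-1 ^+ k)).
  apply: ler_sum => k _; rewrite /bump/= add1n add0n.
  have k0 : 0 < 2 ^+ k :> R by rewrite exprn_gt0.
  have q1 : 0 < q + 1 by lra.
  have h := powR_expR_le q1 k0.
  rewrite exprS powRM ?(ltW k0)// mulrCA -(mulrA (2 `^ q)); apply: ler_wpM2l.
    exact: powR_ge0.
  rewrite exprVn ler_pdivlMr//; apply: le_trans h.
  rewrite powRD; last by rewrite (gt_eqF k0) implybT.
  rewrite powRr1 ?(ltW k0)// le_eqVlt; apply/orP; left; apply/eqP; ring.
rewrite -mulr_sumr ler_wpM2l ?mulr_ge0 ?powR_ge0//; exact: sum_half_le.
Qed.

(** Used with [y] a random factor of the loss and [z] a majorant of the indicator of a layer: it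
    does the work of Cauchy-Schwarz, with [t] tuned to the probability of the layer. *)
Lemma le_half_sqr_invr (t y z : R) : 0 < t -> 1 <= z ->
  y <= 2^-1 * (t * y ^+ 2 + t^-1 * z).
Proof.
move=> t0 z1; have t0' : t != 0 by rewrite gt_eqF.
have h : 0 <= t * (y - t^-1) ^+ 2 by rewrite mulr_ge0 ?sqr_ge0 ?ltW.
have {h} : 0 <= t * y ^+ 2 - 2 * y + t^-1.
  by apply: le_trans h _; rewrite le_eqVlt; apply/orP; left; apply/eqP; field.
have : t^-1 * 1 <= t^-1 * z by rewrite ler_pM2l ?invr_gt0.
lra.
Qed.

(** 33 rounds up [(64 + 1) / 2], where 64 is the second moment allowed to [Q] and 1 comes from the
    tail bound of a layer; the other factor is the bound of [sum_layer_rate_le]. *)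
Definition layer_const (q : R) : R :=
  33 * (1 + 2 `^ q * (2 * (q + 1)) `^ (q + 1) * 2).

Lemma layer_const_ge0 q : 0 <= q -> 0 <= layer_const q.
Proof. by move=> q0; rewrite mulr_ge0// addr_ge0// !mulr_ge0 ?powR_ge0. Qed.

(* A measurable majorant rather than a bound on the integral of [Z]: integrals
   of nonmeasurable functions are not subadditive. *)
Lemma layered_majorant (q : R) d (T : measurableType d)
    (P : probability T R) (I : finType) (x Z : T -> R) (Q : I -> T -> R)
    (c : R -> I -> R) (u0 A M : R) :
  0 <= q -> 0 < u0 -> 0 <= A ->
  (forall w, x w <= M) -> (forall w, 0 <= Z w) ->
  (forall w u, u0 <= u -> x w <= u -> Z w <= \sum_i c u i * Q i w) ->
  (forall i, measurable_fun setT (Q i)) ->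
  (forall i, \int[P]_w (Q i w ^+ 2)%:E <= 64%:E)%E ->
  (forall u i, u0 <= u -> 0 <= c u i) ->
  (forall u, u0 <= u -> \sum_i c u i <= A * u `^ q) ->
  (forall u, u0 <= u -> exists G : T -> R,
    [/\ measurable_fun setT G, forall w, 0 <= G w,
        forall w, u < x w -> 1 <= G w &
        (\int[P]_w (G w)%:E <= (expR (- (u / u0)))%:E)%E]) ->
  exists W : T -> R, [/\ measurable_fun setT W, forall w, Z w <= W w &
    (\int[P]_w (W w)%:E <= (layer_const q * A * u0 `^ q)%:E)%E].
Proof.
move=> q0 u00 A0 xM Z0 ZQ mQ Q64 c0 cA hG.
pose v k := u0 * 2 ^+ k.
have vu k : u0 <= v k by rewrite ler_peMr ?(ltW u00)// exprn_ege1// ler1n.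
(* [G k] majorises the indicator of the layer [v (k - 1) < x <= v k], so the tail bound is taken at
   the level below; for [k = 0] the constant 1 serves. *)
have /choice[G hG'] : forall k, exists Gk : T -> R,
    [/\ measurable_fun setT Gk, forall w, 0 <= Gk w,
        forall w, (if k is k'.+1 then v k' < x w else True) -> 1 <= Gk w &
        (\int[P]_w (Gk w)%:E <= (layer_rate k ^+ 2)%:E)%E].
  case=> [|k].
    exists (cst 1); split => //.
    rewrite [leLHS](_ : _ = \int[P]_w (cst 1 w))%E//.
    by rewrite integral_cst//= probability_setT mule1 expr1n.
  have [G [mG G0 G1 Gle]] := hG _ (vu k); exists G; split => //.
  apply: le_trans Gle _; rewrite lee_fin -expRM_natl ler_expR.
  rewrite le_eqVlt; apply/orP; left; apply/eqP; rewrite /v; field.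
  by rewrite gt_eqF.
have mG k : measurable_fun setT (G k) by have [] := hG' k.
have G0 k w : 0 <= G k w by have [_] := hG' k.
(* Boundedness of [x] leaves finitely many layers. *)
have [m hm] : exists m, M <= v m.
  exists (Num.trunc (M / u0)).+1; rewrite -ler_pdivrMl// mulrC.
  apply: (le_trans (ltW (truncnS_gt _))).
  by rewrite -natrX ler_nat ltnW// ltn_expl.
pose t := layer_rate; have t0 k : 0 < t k := layer_rate_gt0 k.
pose F k i w := 2^-1 * (t k * Q i w ^+ 2 + (t k)^-1 * G k w).
have F0 k i w : 0 <= F k i w.
  by rewrite mulr_ge0// addr_ge0// mulr_ge0 ?sqr_ge0 ?invr_ge0// ltW.
have ZF w : Z w <= \sum_(k < m.+1) \sum_i c (v k) i * F k i w.
  have [k km [xk Gk]] : exists2 k, (k < m.+1)%N & x w <= v k /\ 1 <= G k w.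
    have ex : exists k, x w <= v k by exists m; apply: le_trans (xM w) hm.
    (* For the least [k] with [x w <= v k], minimality gives [v (k - 1) < x w] when [k > 0], hence
       [G k w >= 1]. *)
    exists (ex_minn ex); case: ex_minnP => k xk kmin.
      by rewrite ltnS; apply: kmin; apply: le_trans (xM w) hm.
    split => //; have [_ _ + _] := hG' k; apply.
    case: k xk kmin => // k xk kmin; rewrite ltNge; apply/negP => /kmin.
    by rewrite ltnn.
  rewrite (bigD1 (Ordinal km))//=; apply: (le_trans (ZQ _ _ (vu k) xk)).
  rewrite ler_wpDr//; last first.
    by apply: ler_sum => i _; rewrite ler_wpM2l ?c0// le_half_sqr_invr.
  by do 2 (apply: sumr_ge0 => ? _); rewrite mulr_ge0 ?c0.
have mF k i : measurable_fun setT (F k i).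
  apply: measurable_funM => //; apply: measurable_funD; apply: measurable_funM => //.
  exact: measurable_funX.
have intF k i : (\int[P]_w (F k i w)%:E <= (33 * t k)%:E)%E.
  under eq_integral do rewrite EFinM.
  rewrite ge0_integralZl ?lee_fin//; last 2 first.
  - by apply/measurable_EFinP; apply: measurable_funD; apply: measurable_funM => //;
       exact: measurable_funX.
  - by move=> w _; rewrite lee_fin addr_ge0// mulr_ge0 ?sqr_ge0 ?invr_ge0// ltW.
  under eq_integral do rewrite EFinD (EFinM (t k)) (EFinM (t k)^-1).
  rewrite ge0_integralD//; last 4 first.
  - by move=> w _; rewrite -EFinM lee_fin mulr_ge0 ?sqr_ge0// ltW.
  - by apply: measurable_funeM; apply/measurable_EFinP; exact: measurable_funX.
  - by move=> w _; rewrite -EFinM lee_fin mulr_ge0 ?invr_ge0// ltW.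
  - by apply: measurable_funeM; exact/measurable_EFinP.
  rewrite !ge0_integralZl ?lee_fin ?invr_ge0 ?(ltW (t0 k))//; last 4 first.
  - exact/measurable_EFinP.
  - by move=> w _; rewrite lee_fin.
  - by apply/measurable_EFinP; exact: measurable_funX.
  - by move=> w _; rewrite lee_fin sqr_ge0.
  have [_ _ _ Gk] := hG' k.
  apply: (@le_trans _ _ ((2^-1)%:E *
      ((t k)%:E * 64%:E + (t k)^-1%:E * (t k ^+ 2)%:E))%E).
    apply: lee_wpmul2l; rewrite ?lee_fin//.
    by apply: leeD; apply: lee_wpmul2l; rewrite ?lee_fin ?invr_ge0 ?(ltW (t0 k)).
  rewrite -(EFinM (t k)) -(EFinM (t k)^-1) -EFinD -EFinM lee_fin expr2 mulKf ?gt_eqF//.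
  by have := t0 k; lra.
exists (fun w => \sum_(k < m.+1) \sum_i c (v k) i * F k i w); split => //.
  by apply: measurable_sum => k; apply: measurable_sum => i; exact: measurable_funM.
under eq_integral do rewrite -sumEFin.
rewrite ge0_integral_sum//; last 2 first.
- move=> k; apply/measurable_EFinP/measurable_sum => i.
  exact: measurable_funM.
- by move=> k w _; rewrite lee_fin sumr_ge0// => i _; rewrite mulr_ge0 ?c0.
apply: (@le_trans _ _ (\sum_(k < m.+1) (33 * A * u0 `^ q * (t k * (2 ^+ k) `^ q))%:E)%E).
  apply: lee_sum => k _; under eq_integral do rewrite -sumEFin.
  rewrite ge0_integral_sum//; last 2 first.
  - by move=> i; apply/measurable_EFinP; exact: measurable_funM.
  - by move=> i w _; rewrite lee_fin mulr_ge0 ?c0.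
  apply: (@le_trans _ _ (\sum_i (c (v k) i * (33 * t k))%:E)%E).
    apply: lee_sum => i _; under eq_integral do rewrite EFinM.
    rewrite ge0_integralZl ?lee_fin ?c0//; last 2 first.
    - exact/measurable_EFinP.
    - by move=> w _; rewrite lee_fin.
    by rewrite EFinM lee_wpmul2l ?lee_fin ?c0.
  rewrite sumEFin lee_fin -mulr_suml.
  apply: (@le_trans _ _ (A * v k `^ q * (33 * t k))).
    by rewrite ler_wpM2r ?cA// mulr_ge0// ltW.
  rewrite /v powRM ?exprn_ge0 ?(ltW u00)//.
  by rewrite le_eqVlt; apply/orP; left; apply/eqP; ring.
rewrite sumEFin lee_fin -mulr_sumr.
have -> : layer_const q * A * u0 `^ q =
  33 * A * u0 `^ q * (1 + 2 `^ q * (2 * (q + 1)) `^ (q + 1) * 2).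
  by rewrite /layer_const; ring.
by rewrite ler_wpM2l ?mulr_ge0 ?powR_ge0//; exact: sum_layer_rate_le.
Qed.
End DyadicLayers.

(** * Sums of truncated powers *)

Section PowerSums.
Context (R : realType).

(** Dividing by [(x + 1)^(- e)] leaves [y^(- e) >= 1 + e * (1 - y)] for [y = x / (x + 1)], which
    follows from [ln y <= y - 1] and [exp z >= 1 + z]. *)
Lemma powRN_sub_succ_ge (e x : R) : 0 < e -> 0 < x ->
  e * (x + 1) `^ (- e - 1) <= x `^ (- e) - (x + 1) `^ (- e).
Proof.
move=> e0 x0; have x1 : 0 < x + 1 by lra.
rewrite powRD ?(gt_eqF x1) ?implybT// powR_inv1 ?(ltW x1)//.
set y := x / (x + 1).
have y0 : 0 < y by rewrite divr_gt0.
have -> : x `^ (- e) = (x + 1) `^ (- e) * y `^ (- e).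
  by rewrite -powRM ?ltW// /y mulrC divfK ?gt_eqF.
rewrite -[X in _ - X]mulr1 -mulrBr mulrCA; apply: ler_wpM2l.
  exact: powR_ge0.
rewrite /powR gt_eqF// lerBrDr.
have lny : ln (1 + (y - 1)) <= y - 1 by apply: le_ln1Dx; lra.
rewrite addrCA subrr addr0 in lny.
have h : e * (1 - y) <= - e * ln y.
  by rewrite mulNr -mulrN; apply: ler_wpM2l; [exact: ltW|lra].
apply: le_trans (expR_ge1Dx _); rewrite addrC lerD2l; apply: le_trans h.
by rewrite le_eqVlt; apply/orP; left; apply/eqP; rewrite /y; field; rewrite gt_eqF.
Qed.

(** Indices up to [n] contribute order [n^(q + 1)]; beyond [n] the summand is [n^p * i^(q - p)],
    whose sum has the same order because [p - q > 1]. The constant is uniform in [n] and [D]. *)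
Lemma sum_powR_min_le (p q : R) : 0 <= q -> q + 1 < p ->
  exists2 C : R, 0 <= C & forall (n : R) (D : nat), 1 <= n ->
  \sum_(i < D) i.+1%:R `^ q * Num.min 1 ((n / i.+1%:R) `^ p) <= C * n `^ (q + 1).
Proof.
move=> q0 qp; pose e := p - q - 1; have e0 : 0 < e by rewrite /e; lra.
exists (2 `^ (q + 1) + e^-1); first by rewrite addr_ge0 ?powR_ge0 ?invr_ge0 ?ltW.
move=> n D n1; have n0 : 0 < n by lra.
(* The sum telescopes: the first part of [psi] counts the indices up to
   [n + 1], the second one is a primitive of the tail. *)
pose psi (j : nat) : R := (2 * n) `^ q * Num.min j%:R (n + 1)
  - e^-1 * (n `^ p * (Num.max j%:R n) `^ (- e)).
have mono (a b : R) : 0 < a -> a <= b -> b `^ (- e) <= a `^ (- e).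
  move=> a0 ab; rewrite !powRN lef_pV2 ?posrE ?powR_gt0//; last by lra.
  by apply: ge0_ler_powR; rewrite ?nnegrE; lra.
have step j : j.+1%:R `^ q * Num.min 1 ((n / j.+1%:R) `^ p) <= psi j.+1 - psi j.
  have j1 : (j.+1%:R : R) = j%:R + 1 by rewrite -natr1.
  have j0 : 0 <= j%:R :> R by [].
  have [jn|jn] := leP j%:R n.
    have -> : psi j.+1 - psi j = (2 * n) `^ q + e^-1 *
       (n `^ p * ((Num.max j%:R n) `^ (- e) - (Num.max j.+1%:R n) `^ (- e))).
      rewrite /psi (min_l (_ : j.+1%:R <= _)) ?j1 ?lerD2r//.
      by rewrite min_l; [ring|lra].
    apply: ler_wpDr.
      rewrite mulr_ge0 ?invr_ge0 ?(ltW e0)// mulr_ge0 ?powR_ge0// subr_ge0.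
      apply: mono; first by rewrite lt_max n0 orbT.
      by rewrite ge_max !le_max j1 lerDl ler01/= lexx orbT.
    rewrite -[leRHS]mulr1; apply: ler_pM; rewrite ?powR_ge0//.
    - by rewrite le_min ler01 powR_ge0.
    - by apply: ge0_ler_powR; rewrite ?nnegrE ?j1; lra.
  have jp : 0 < j%:R :> R by lra.
  apply: (@le_trans _ _ (j.+1%:R `^ q * (n / j.+1%:R) `^ p)).
    by apply: ler_wpM2l; rewrite ?powR_ge0// ge_min lexx orbT.
  rewrite /psi (min_r (_ : n + 1 <= j.+1%:R)); last by lra.
  rewrite (max_l (_ : n <= j.+1%:R)); last by lra.
  rewrite (max_l (ltW jn)).
  have h := powRN_sub_succ_ge e0 jp; rewrite -j1 in h.
  have h2 : (2 * n) `^ q * Num.min j%:R (n + 1) <= (2 * n) `^ q * (n + 1).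
    by apply: ler_wpM2l; rewrite ?powR_ge0// ge_min lexx orbT.
  have h3 : e^-1 * (n `^ p * (e * j.+1%:R `^ (- e - 1))) <=
     e^-1 * (n `^ p * (j%:R `^ (- e) - j.+1%:R `^ (- e))).
    by do 2 (apply: ler_wpM2l; rewrite ?powR_ge0 ?invr_ge0 ?(ltW e0)//).
  have -> : j.+1%:R `^ q * (n / j.+1%:R) `^ p =
      e^-1 * (n `^ p * (e * j.+1%:R `^ (- e - 1))).
    rewrite powRM ?(ltW n0) ?invr_ge0// -powR_inv1// -powRrM mulN1r.
    rewrite [RHS]mulrCA mulKf ?gt_eqF// mulrCA -powRD; last first.
      by rewrite pnatr_eq0 implybT.
    by congr (_ * _ `^ _); rewrite /e; ring.
  lra.
apply: (@le_trans _ _ (psi D - psi 0%N)).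
  elim: D => [|D IH]; first by rewrite big_ord0 subrr.
  rewrite big_ord_recr/=; apply: le_trans (lerD IH (step D)) _.
  by rewrite addrC addrA subrK.
rewrite {2}/psi mulr0n min_l; last by lra.
rewrite mulr0 max_r; last by lra.
rewrite -powRD; last by rewrite (gt_eqF n0) implybT.
have -> : p + - e = q + 1 by rewrite /e; ring.
have : psi D <= (2 * n) `^ q * (2 * n).
  rewrite /psi lerBlDr ler_wpDr//.
    by rewrite !mulr_ge0 ?powR_ge0 ?invr_ge0 ?(ltW e0).
  by apply: ler_wpM2l; rewrite ?powR_ge0// ge_min; apply/orP; right; lra.
have -> : (2 * n) `^ q * (2 * n) = 2 `^ (q + 1) * n `^ (q + 1).
  rewrite -powRM ?(ltW n0)// powRD ?powRr1; first by []; first by lra.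
  by rewrite mulf_neq0 ?implybT// gt_eqF.
lra.
Qed.
End PowerSums.

(** * Level crossings of continuous paths *)

Section MonotonePaths.
Context (R : realType).

Lemma cvg_sum_comp (T : Type) (F : set_system T) (FF : Filter F) (I : finType)
    (f : I -> T -> R) (l : I -> R) (h : I -> R -> R) :
  (forall i, continuous (h i)) -> (forall i, f i @ F --> l i) ->
  (fun t => \sum_i h i (f i t)) @ F --> \sum_i h i (l i).
Proof.
move=> hc fl; elim: (index_enum I) => [|i s IHs].
  under eq_fun do rewrite big_nil.
  by rewrite big_nil; exact: cvg_cst.
under eq_fun do rewrite big_cons.
rewrite big_cons; apply: cvgD => //.
by apply: (@cvg_comp _ _ _ (f i) (h i) _ _ _ (fl i)); exact: hc.
Qed.

(** If [f (inf S) < c], the intermediate value theorem gives [s > inf S] with [f s < c], and by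
    monotonicity [s] is a lower bound of [S]. This turns times defined as infima into inequalities
    that hold at these times. *)
Lemma le_inf_level (f : R -> R) (t0 c : R) (S : set R) : 0 <= t0 ->
  {within [set t | 0 <= t], continuous f} ->
  (forall s t, t0 <= s -> s <= t -> f s <= f t) ->
  (forall t, S t -> t0 <= t /\ c <= f t) -> S !=set0 ->
  t0 <= inf S /\ c <= f (inf S).
Proof.
move=> t00 cf mf hS S0.
have t0S : t0 <= inf S by apply: lb_le_inf => // t /hS[].
have hlb : has_lbound S by exists t0 => t /hS[].
split => //; rewrite leNgt; apply/negP => fc.
have [T ST] := S0; have [t0T cT] := hS _ ST.
have sT : inf S <= T by exact: ge_inf.
pose v := (f (inf S) + c) / 2.
have [||s] := @IVT R f (inf S) T v sT.
- apply: continuous_subspaceW cf => x /=; rewrite in_itv/= => /andP[h _].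
  exact: le_trans (le_trans t00 t0S) h.
- rewrite min_l ?max_r ?mf// /v; apply/andP; split; lra.
rewrite in_itv/= => /andP[s1 s2] fs.
have lt1 : inf S < s.
  rewrite lt_neqAle s1 andbT; apply/eqP => e; move: fs; rewrite -e /v; lra.
have : s <= inf S.
  apply: lb_le_inf => // t St; have [t0t ct] := hS _ St.
  rewrite leNgt; apply/negP => ts.
  have := mf _ _ t0t (ltW ts); rewrite fs /v; lra.
lra.
Qed.

Lemma level_attained (f : R -> R) (t0 T c : R) : 0 <= t0 -> t0 <= T ->
  {within [set t | 0 <= t], continuous f} ->
  Num.min (f t0) (f T) <= c <= Num.max (f t0) (f T) ->
  exists2 t, t0 <= t & f t = c.
Proof.
move=> t00 t0T cf hc; have [|t] := @IVT R f t0 T c t0T _ hc.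
  apply: continuous_subspaceW cf => x /=; rewrite in_itv/= => /andP[h _].
  exact: le_trans t00 h.
by rewrite in_itv/= => /andP[? _]; exists t.
Qed.

End MonotonePaths.

Lemma continuous_sqr1B (R : realType) (c : R) :
  continuous (fun x : R => (1 - x) ^+ 2 * c).
Proof.
move=> x; apply: cvgMl.
apply: (@cvg_comp _ _ _ (fun y : R => 1 - y) (fun y => y ^+ 2) _ (nbhs (1 - x))).
  by apply: cvgB; [exact: cvg_cst|exact: cvg_id].
exact: exprn_continuous.
Qed.

(** * Effective dimension and residuals along the filter path *)

Section FilterPaths.
Context (R : realType) (D : nat) (gamma : R -> 'I_D -> R).
Hypothesis gamma01 : forall t i, 0 <= t -> 0 <= gamma t i <= 1.
Hypothesis gamma_nd : forall s t i, 0 <= s -> s <= t -> gamma s i <= gamma t i.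
Hypothesis gamma_cont :
  forall i, {within [set t | 0 <= t], continuous (gamma ^~ i)}.
Hypothesis gamma_lim : forall i, (gamma ^~ i) t @[t --> +oo] --> (1 : R).

Definition effdim t : R := \sum_i gamma t i ^+ 2.

(* The weak bias divided by [delta^2] for [b = lam * mu / delta], the strong
   bias for [b = mu], the residual divided by [delta^2] for
   [b = lam * mu / delta + e]. *)
Definition wres (b : 'I_D -> R) t : R := \sum_i (1 - gamma t i) ^+ 2 * b i ^+ 2.

Lemma effdim_nd s t : 0 <= s -> s <= t -> effdim s <= effdim t.
Proof.
move=> s0 st; apply: ler_sum => i _.
have /andP[g0 _] := gamma01 i s0.
by rewrite ler_sqr ?nnegrE ?gamma_nd//; exact: le_trans g0 (gamma_nd _ _ _).
Qed.

Lemma effdim_le t : 0 <= t -> effdim t <= D%:R.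
Proof.
move=> t0; rewrite -[D in leRHS]card_ord -sum1_card natr_sum; apply: ler_sum => i _.
by have /andP[g0 g1] := gamma01 i t0; rewrite expr_le1.
Qed.

Lemma wres_ge0 b t : 0 <= wres b t.
Proof. by apply: sumr_ge0 => i _; rewrite mulr_ge0 ?sqr_ge0. Qed.

Lemma wres_ni b s t : 0 <= s -> s <= t -> wres b t <= wres b s.
Proof.
move=> s0 st; apply: ler_sum => i _; apply: ler_wpM2r; first exact: sqr_ge0.
have t0 := le_trans s0 st.
have /andP[_ gs] := gamma01 i s0; have /andP[_ gt] := gamma01 i t0.
by rewrite ler_sqr ?nnegrE ?subr_ge0// lerD2l lerN2 gamma_nd.
Qed.

Lemma continuous_effdim : {within [set t | 0 <= t], continuous effdim}.
Proof.
apply/subspace_continuousP => t t0.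
apply: (@cvg_sum_comp R _ _ _ _ (fun i => gamma ^~ i) _ (fun _ x => x ^+ 2)).
  by move=> _; exact: exprn_continuous.
by move=> i; move/subspace_continuousP : (@gamma_cont i) => /(_ t t0).
Qed.

Lemma continuous_wres b : {within [set t | 0 <= t], continuous (wres b)}.
Proof.
apply/subspace_continuousP => t t0.
apply: (@cvg_sum_comp R _ _ _ _ (fun i => gamma ^~ i) _
  (fun i x => (1 - x) ^+ 2 * b i ^+ 2)).
  by move=> i; exact: continuous_sqr1B.
by move=> i; move/subspace_continuousP : (@gamma_cont i) => /(_ t t0).
Qed.

Lemma effdim_lim (t0 c : R) : c < D%:R -> exists2 t, t0 <= t & c < effdim t.
Proof.
move=> cD.
have h : effdim t @[t --> +oo] --> (D%:R : R).
  have -> : (D%:R : R) = \sum_(i < D) 1 ^+ 2.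
    by rewrite -[D in LHS]card_ord -sum1_card natr_sum; under [RHS]eq_bigr do rewrite expr1n.
  apply: (@cvg_sum_comp R _ _ _ _ (fun i => gamma ^~ i) _ (fun _ x => x ^+ 2)) => //.
  by move=> _; exact: exprn_continuous.
have /filter_ex[t [tc t0t]] : \forall t \near +oo, c < effdim t /\ t0 <= t.
  apply: filterI; last exact/nbhs_pinfty_ge/num_real.
  exact: (cvgr_gt _ h).
by exists t.
Qed.

Lemma wres_lim b (t0 c : R) : 0 < c -> exists2 t, t0 <= t & wres b t < c.
Proof.
move=> c0.
have h : wres b t @[t --> +oo] --> (0 : R).
  have -> : 0 = \sum_i (1 - 1) ^+ 2 * b i ^+ 2.
    by rewrite big1// => i _; rewrite subrr expr0n mul0r.
  apply: (@cvg_sum_comp R _ _ _ _ (fun i => gamma ^~ i) _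
    (fun i x => (1 - x) ^+ 2 * b i ^+ 2)) => //.
  by move=> i; exact: continuous_sqr1B.
have /filter_ex[t [tc t0t]] : \forall t \near +oo, wres b t < c /\ t0 <= t.
  apply: filterI; last exact/nbhs_pinfty_ge/num_real.
  exact: (cvgr_lt _ h).
by exists t.
Qed.

Lemma inf_effdim_eq (c : R) : 0 <= c -> c < D%:R ->
  (forall i, gamma 0 i = 0) ->
  let t := inf [set t | 0 <= t /\ effdim t = c] in 0 <= t /\ c <= effdim t.
Proof.
move=> c0 cD g0; apply: (le_inf_level (lexx 0) continuous_effdim).
- by move=> s t; exact: effdim_nd.
- by move=> t [t0 ->].
have [t1 t10 ct1] := effdim_lim 0 cD.
have N0 : effdim 0 = 0 by apply: big1 => i _; rewrite g0 expr0n.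
have [|t t0 Nt] := @level_attained R effdim 0 t1 c (lexx 0) t10 continuous_effdim.
  by rewrite N0 min_l ?max_r ?c0 ?(ltW ct1)// (le_trans c0) ?ltW.
by exists t.
Qed.

Lemma inf_wres_le b (t0 c : R) : 0 <= t0 -> 0 < c ->
  let tau := inf [set t | t0 <= t /\ wres b t <= c] in
  [/\ t0 <= tau, wres b tau <= c & forall t, t0 <= t -> t < tau -> c < wres b t].
Proof.
move=> t00 c0 tau.
have [h1 h2] : t0 <= tau /\ - c <= - wres b tau.
  apply: (@le_inf_level R (fun t => - wres b t) t0 (- c) _ t00).
  - by move=> x; apply: cvgN; exact: continuous_wres.
  - by move=> s t s0 st; rewrite lerN2; apply: wres_ni => //; exact: le_trans s0.
  - by move=> t [t0t]; rewrite lerN2.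
  by have [t t0t /ltW] := wres_lim b t0 c0; exists t.
split=> //; first by rewrite -lerN2.
move=> t t0t; rewrite !ltNge; apply: contra => ht.
by apply: ge_inf => //; exists t0 => x [].
Qed.

Lemma inf_wres_le_effdim b (t0 : R) : 0 <= t0 -> 1 <= effdim t0 ->
  let t1 := inf [set t | t0 <= t /\ wres b t <= effdim t] in
  t0 <= t1 /\ wres b t1 <= effdim t1.
Proof.
move=> t00 N1 t1; rewrite -[wres b t1 <= _]subr_ge0.
apply: (@le_inf_level R (fun t => effdim t - wres b t) t0 0 _ t00).
- by move=> x; apply: cvgB; [exact: continuous_effdim|exact: continuous_wres].
- move=> s t s0 st; have s00 := le_trans t00 s0.
  by apply: lerB; [exact: effdim_nd|exact: wres_ni].
- by move=> t [t0t]; rewrite subr_ge0.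
have [t tt ht] := wres_lim b t0 (ltr01 : 0 < (1 : R)).
exists t; split => //; apply: (le_trans (ltW ht)); apply: (le_trans N1).
exact: effdim_nd.
Qed.

(** * Bias and noise at the stopping time *)

Section StoppedErrors.
Context d (T : measurableType d) (P : probability T R).
Context (e : 'I_D -> {RV P >-> R}).
Hypothesis e_indep : mutually_independent e.
Hypothesis e_normal : forall i, standard_normal (e i).
Variables (a : 'I_D -> R) (kappa Ck C1 t0 t1 : R) (tau : T -> R).
Hypothesis t0_ge0 : 0 <= t0.
Hypothesis t01 : t0 <= t1.
Hypothesis Ck_ge0 : 0 <= Ck.
Hypothesis D_ge1 : 1 <= D%:R :> R.
Hypothesis kappa_near : `|kappa - D%:R| <= Ck * Num.sqrt D%:R.
Hypothesis t1_balanced : wres a t1 <= effdim t1.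
Hypothesis t1_large : Num.sqrt D%:R <= effdim t1.
Hypothesis t1_trace : \sum_i gamma t1 i <= C1 * effdim t1.
Hypothesis tau_ge : forall w, t0 <= tau w.

Let obs w i : R := a i + e i w.
Let sD : R := Num.sqrt D%:R.

Let sD_ge1 : 1 <= sD.
Proof. by rewrite -sqrtr1 ler_sqrt. Qed.

Let sD2 : sD ^+ 2 = D%:R.
Proof. by rewrite sqr_sqrtr. Qed.

Let wt01 t i : 0 <= t -> 0 <= (1 - gamma t i) ^+ 2 <= 1.
Proof.
move=> t_ge0; have /andP[g0 g1] := gamma01 i t_ge0.
by rewrite sqr_ge0 expr_le1 ?subr_ge0// gerBl.
Qed.

Hypothesis tau_stop : forall w, wres (obs w) (tau w) <= kappa.

(** With [t] chosen so that [wres a t = u], the event [u < wres a (tau w)] forces [tau w <= t],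
    hence a residual at most [kappa] at the fixed time [t]. Its mean there is at least
    [D + u - 2 * C1 * effdim t1], so this is a lower-tail event of a quadratic form. *)
Lemma early_level (u : R) : 6 * (2 * C1 + 4 + Ck) * effdim t1 <= u ->
  0 <= C1 ->
  exists G : T -> R, [/\ measurable_fun setT G, forall w, 0 <= G w,
    forall w, u < wres a (tau w) -> 1 <= G w &
    (\int[P]_w (G w)%:E <=
     (expR (- (u / (6 * (2 * C1 + 4 + Ck) * effdim t1))))%:E)%E].
Proof.
set K := 2 * C1 + 4 + Ck => hu C10.
have [Ck0 s1 NsD] := And3 Ck_ge0 sD_ge1 t1_large; rewrite -/sD in NsD.
have [hb htr hk0] := And3 t1_balanced t1_trace kappa_near.
have t1_ge0 := le_trans t0_ge0 t01.
have N1 : 1 <= effdim t1 := le_trans sD_ge1 t1_large.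
have K4 : 4 <= K by rewrite /K; lra.
have KN : effdim t1 < 6 * K * effdim t1 by rewrite ltr_pMl; lra.
(* From the initial bias on, the event is empty and the zero function serves. *)
have [ub|ub] := leP (wres a t0) u.
  exists (cst 0); split => //.
    move=> w; rewrite ltNge (le_trans _ ub)//; exact: wres_ni.
  by rewrite integral0_eq// lee_fin expR_ge0.
have [T1 t0T1 wT1] : exists2 t, t0 <= t & wres a t < u.
  by apply: wres_lim; lra.
have [|t t0t wtu] := @level_attained R (wres a) t0 T1 u t0_ge0 t0T1
    (@continuous_wres a).
  by rewrite min_r ?max_l ?wres_ni// (ltW wT1) ltW.
have t_ge0 := le_trans t0_ge0 t0t.
(* The trace bound is known at [t1]; it transfers to [t <= t1], which holds since the bias at [t1]
   is already below [u]. *)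
have tt1 : t <= t1.
  rewrite leNgt; apply/negP => lt1.
  by have := wres_ni a t1_ge0 (ltW lt1); rewrite wtu; lra.
(* With [s = D^(-1/2)] the term [4 * s ^+ 2 * D] equals 4 and [s * (kappa - D)] is at most [Ck]. The
   exponent is then at most [K * s * effdim t1 - s * u / 3], and [u >= 6 * K * effdim t1] leaves
   [- s * u / 6]. *)
pose s := sD^-1.
have sgt0 : 0 < s by rewrite invr_gt0; lra.
have sle1 : s <= 1 by rewrite invf_le1; lra.
exists (fun w => expR (- s * wres (obs w) t + s * kappa)); split.
- exact: measurable_quadratic_form.
- by move=> w; exact: expR_ge0.
- move=> w uw; rewrite -[leLHS]expR0 ler_expR mulNr addrC -mulrBr.
  rewrite mulr_ge0 ?(ltW sgt0)// subr_ge0.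
  apply: le_trans (tau_stop w); apply: wres_ni; first exact: le_trans t0_ge0 _.
  rewrite leNgt; apply/negP => ltt.
  have := @wres_ni a t (tau w) t_ge0 (ltW ltt); rewrite wtu.
  by rewrite leNgt uw.
under eq_integral do rewrite expRD mulrC EFinM.
rewrite ge0_integralZl ?lee_fin ?expR_ge0//; last first.
  have := @measurable_quadratic_form _ _ _ P D e a (fun i => (1 - gamma t i) ^+ 2) (- s) 0.
  by under eq_fun do rewrite addr0; move/measurable_EFinP.
have h := @integral_expR_quadratic_form_le _ _ _ P D e e_indep e_normal a _
  (fun i => wt01 i t_ge0) s.
apply: (@le_trans _ _ ((expR (s * kappa))%:E * (expR
  (- s * (\sum_i (1 - gamma t i) ^+ 2) + 4 * s ^+ 2 * D%:R - s / 3 * u))%:E)%E).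
  by apply: lee_wpmul2l; rewrite ?lee_fin ?expR_ge0// -wtu; apply: h; rewrite ltW.
rewrite -EFinM -expRD lee_fin ler_expR.
have s2D : s ^+ 2 * D%:R = 1.
  by rewrite -sD2 exprVn mulVf// sqrf_eq0; lra.
have sC : s * (Ck * sD) = Ck by rewrite mulrC -mulrA divff ?mulr1//; lra.
have hk : s * kappa <= s * D%:R + Ck.
  by rewrite -sC -mulrDr ler_pM2l//; move: kappa_near; rewrite ler_norml -/sD; lra.
have hW : D%:R - \sum_i (1 - gamma t i) ^+ 2 <= 2 * C1 * effdim t1.
  apply: (@le_trans _ _ (2 * \sum_i gamma t1 i)); last by lra.
  have -> : D%:R = \sum_(i < D) (1 : R) by rewrite sumr_const card_ord.
  rewrite -sumrB mulr_sumr.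
  apply: ler_sum => i _; have /andP[g0 g1] := gamma01 i t_ge0.
  have := gamma_nd i t_ge0 tt1; nra.
have sN1 : 1 <= s * effdim t1.
  by rewrite mulrC ler_pdivlMr ?mul1r//; lra.
have hsW : s * (D%:R - \sum_i (1 - gamma t i) ^+ 2) <= s * (2 * C1 * effdim t1).
  by rewrite ler_pM2l.
have hsu : s * (6 * K * effdim t1) <= s * u by rewrite ler_pM2l.
have hend : u / (6 * K * effdim t1) <= s * u / 6.
  have -> : s * u / 6 = u * (6 * sD)^-1 by rewrite /s; field; lra.
  apply: ler_wpM2l; first by lra.
  have : effdim t1 * 1 <= effdim t1 * K by rewrite ler_pM2l; lra.
  by rewrite lef_pV2 ?posrE; lra.
have hCk : Ck + 4 <= (Ck + 4) * (s * effdim t1) by rewrite ler_peMr; lra.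
have hK : K * (s * effdim t1) =
    2 * C1 * (s * effdim t1) + (Ck + 4) * (s * effdim t1) by rewrite /K; ring.
clear hu KN K4 hW; clearbody K; lra.
Qed.

Hypothesis tau_min : forall w t, t0 <= t -> t < tau w -> kappa < wres (obs w) t.

(** With [effdim t = u], the event [u < effdim (tau w)] forces [t < tau w], hence a residual above
    [kappa] at the fixed time [t], although its mean is at most [D - u + effdim t1]: an upper-tail
    event. *)
Lemma late_level (u : R) : 8 * (Ck + 3) * effdim t1 <= u ->
  exists G : T -> R, [/\ measurable_fun setT G, forall w, 0 <= G w,
    forall w, u < effdim (tau w) -> 1 <= G w &
    (\int[P]_w (G w)%:E <=
     (expR (- (u / (8 * (Ck + 3) * effdim t1))))%:E)%E].
Proof.
set K := Ck + 3 => hu.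
have [Ck0 s1 NsD] := And3 Ck_ge0 sD_ge1 t1_large; rewrite -/sD in NsD.
have [hb hk0] := conj t1_balanced kappa_near.
have t1_ge0 := le_trans t0_ge0 t01.
have N1 : 1 <= effdim t1 := le_trans sD_ge1 t1_large.
have K3 : 3 <= K by rewrite /K; lra.
have KN : effdim t1 < 8 * K * effdim t1 by rewrite ltr_pMl; lra.
have [ub|ub] := leP D%:R u.
  exists (cst 0); split => //.
    move=> w; rewrite ltNge (le_trans _ ub)//; apply: effdim_le.
    exact: le_trans t0_ge0 (tau_ge w).
  by rewrite integral0_eq// lee_fin expR_ge0.
have [T1 t1T1 uT1] := @effdim_lim t1 u ub.
have [|t t1t Ntu] := @level_attained R effdim t1 T1 u t1_ge0 t1T1
    continuous_effdim.
  by rewrite min_l ?max_r ?effdim_nd// (ltW uT1) andbT; lra.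
have t_ge0 := le_trans t1_ge0 t1t.
(* The factor 4 ensures [s <= 4^-1], the range of the upper-tail bound, and makes the second-order
   term [4^-1]. The exponent is at most [K * s * effdim t1 - s * u], and the threshold on [u] bounds
   the first term by [s * u / 8]. *)
pose s := (4 * sD)^-1.
have sgt0 : 0 < s by rewrite invr_gt0; lra.
have sle4 : s <= 4^-1 by rewrite lef_pV2 ?posrE; lra.
exists (fun w => expR (s * wres (obs w) t + - (s * kappa))); split.
- exact: measurable_quadratic_form.
- by move=> w; exact: expR_ge0.
- move=> w uw; rewrite -[leLHS]expR0 ler_expR -mulrBr.
  rewrite mulr_ge0 ?(ltW sgt0)// subr_ge0 ltW//.
  apply: tau_min; first exact: le_trans t01 _.
  rewrite ltNge; apply/negP => ltt.
  have := @effdim_nd (tau w) t (le_trans t0_ge0 (tau_ge w)) ltt; rewrite Ntu.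
  by rewrite leNgt uw.
under eq_integral do rewrite expRD mulrC EFinM.
rewrite ge0_integralZl ?lee_fin ?expR_ge0//; last first.
  have := @measurable_quadratic_form _ _ _ P D e a (fun i => (1 - gamma t i) ^+ 2) s 0.
  by under eq_fun do rewrite addr0; move/measurable_EFinP.
have h := @integral_expR_quadratic_form_ge _ _ _ P D e e_indep e_normal a _
  (fun i => wt01 i t_ge0) s.
apply: (@le_trans _ _ ((expR (- (s * kappa)))%:E * (expR
  (s * (\sum_i (1 - gamma t i) ^+ 2) + 4 * s ^+ 2 * D%:R + 2 * s * wres a t))%:E)%E).
  by apply: lee_wpmul2l; rewrite ?lee_fin ?expR_ge0//; apply: h; rewrite ltW.
rewrite -EFinM -expRD lee_fin ler_expR.
have s2D : 4 * s ^+ 2 * D%:R = 4^-1.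
  by rewrite -sD2 /s; field; lra.
have sC : s * (Ck * sD) = Ck / 4 by rewrite /s; field; lra.
have hk : s * D%:R - Ck / 4 <= s * kappa.
  by rewrite -sC -mulrBr ler_pM2l//; move: hk0; rewrite ler_norml -/sD; lra.
have hW : u <= D%:R - \sum_i (1 - gamma t i) ^+ 2.
  rewrite -Ntu; have -> : D%:R = \sum_(i < D) (1 : R) by rewrite sumr_const card_ord.
  rewrite -sumrB; apply: ler_sum => i _; have /andP[g0 g1] := gamma01 i t_ge0.
  nra.
have hbt : s * wres a t <= s * effdim t1.
  by rewrite ler_pM2l//; apply: le_trans hb; exact: wres_ni.
have sN1 : 4^-1 <= s * effdim t1.
  have -> : s * effdim t1 = 4^-1 * (effdim t1 / sD) by rewrite /s; field; lra.
  by rewrite ler_peMr// ler_pdivlMr ?mul1r//; lra.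
have hsW : s * u <= s * (D%:R - \sum_i (1 - gamma t i) ^+ 2).
  by rewrite ler_pM2l.
have hsu : s * (8 * K * effdim t1) <= s * u by rewrite ler_pM2l.
have hend : u / (8 * K * effdim t1) <= s * u / 2.
  have -> : s * u / 2 = u * (8 * sD)^-1 by rewrite /s; field; lra.
  apply: ler_wpM2l; first by lra.
  have : effdim t1 * 1 <= effdim t1 * K by rewrite ler_pM2l; lra.
  by rewrite lef_pV2 ?posrE; lra.
have hCk : Ck * 4^-1 <= Ck * (s * effdim t1) by rewrite ler_wpM2l.
have hK : K * (s * effdim t1) =
    3 * (s * effdim t1) + Ck * (s * effdim t1) by rewrite /K; ring.
clear hu KN K3 hW; clearbody K; lra.
Qed.

Lemma weak_bias_stopped_majorant : 0 <= C1 ->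
  exists W : T -> R, [/\ measurable_fun setT W,
    forall w, wres a (tau w) <= W w &
    (\int[P]_w (W w)%:E <=
     (layer_const 1 * (6 * (2 * C1 + 4 + Ck)) * effdim t1)%:E)%E].
Proof.
move=> C10; have [Ck0 s1 NsD] := And3 Ck_ge0 sD_ge1 t1_large.
have N1 : 1 <= effdim t1 := le_trans sD_ge1 t1_large.
set K := 2 * C1 + 4 + Ck; have K4 : 4 <= K by rewrite /K; lra.
have u0 : 0 < 6 * K * effdim t1 by rewrite !mulr_gt0; lra.
(* A single index with [Q = 1]: below the level [u] the loss is bounded by [u] itself. *)
have := @layered_majorant R 1 _ _ P unit (fun w => wres a (tau w))
  (fun w => wres a (tau w)) (fun _ _ => 1) (fun u _ => u) _ 1 (wres a t0)
  ler01 u0 ler01.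
rewrite powRr1 ?(ltW u0)// mulr1 mulrA; apply.
- by move=> w; exact: wres_ni.
- by move=> w; exact: wres_ge0.
- by move=> w u _ xu; rewrite sumr_const card_unit mulr1 mulr1n.
- by move=> _; exact: measurable_cst.
- move=> _; rewrite [leLHS](_ : _ = \int[P]_w (cst 1 w))%E; last first.
    by apply: eq_integral => w _; rewrite expr1n.
  by rewrite integral_cst//= probability_setT mule1 lee_fin; lra.
- by move=> u _ hu; exact: le_trans (ltW u0) hu.
- move=> u hu; rewrite sumr_const card_unit mulr1n mul1r powRr1//.
  exact: le_trans (ltW u0) hu.
- by move=> u hu; exact: early_level.
Qed.

(** [tau] depends on the noise, so on each layer its filter values are replaced by deterministic
    coefficients [c u i], valid whenever the effective dimension is at most [u]. The noise then
    enters through the fourth moments of [e i]. *)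
Lemma noise_stopped_majorant (q A : R) (l : 'I_D -> R) (c : R -> 'I_D -> R) :
  0 <= q -> 0 <= A -> (forall i, 0 <= l i) -> (forall u i, 0 <= c u i) ->
  (forall u, 1 <= u -> \sum_i c u i <= A * u `^ q) ->
  (forall u t i, t0 <= t -> effdim t <= u -> gamma t i ^+ 2 * l i <= c u i) ->
  exists W : T -> R, [/\ measurable_fun setT W,
    forall w, \sum_i gamma (tau w) i ^+ 2 * l i * e i w ^+ 2 <= W w &
    (\int[P]_w (W w)%:E <=
     (layer_const q * A * (8 * (Ck + 3) * effdim t1) `^ q)%:E)%E].
Proof.
move=> q0 A0 l0 c0 cA hc; have [Ck0 s1 NsD] := And3 Ck_ge0 sD_ge1 t1_large.
have N1 : 1 <= effdim t1 := le_trans sD_ge1 t1_large.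
have u1 : 1 <= 8 * (Ck + 3) * effdim t1.
  have : 1 * 1 <= (8 * (Ck + 3)) * effdim t1 by rewrite ler_pM; lra.
  by rewrite mulr1.
apply: (@layered_majorant R q _ _ P 'I_D (fun w => effdim (tau w)) _
  (fun i w => e i w ^+ 2) c _ A D%:R) => //.
- by lra.
- by move=> w; apply: effdim_le; exact: le_trans t0_ge0 (tau_ge w).
- by move=> w; apply: sumr_ge0 => i _; rewrite mulr_ge0 ?sqr_ge0// mulr_ge0 ?sqr_ge0.
- by move=> w u _ xu; apply: ler_sum => i _; rewrite ler_wpM2r ?sqr_ge0 ?hc.
- by move=> i; exact: measurable_funX.
- by move=> i; exact: standard_normal_fourth_moment.
- by move=> u hu; apply: cA; lra.
- by move=> u hu; exact: late_level.
Qed.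
End StoppedErrors.
End FilterPaths.

(** * Decay of the filters under a polynomial spectrum *)

Section PolynomialSpectrum.
Context (R : realType) (D : nat).
Implicit Types (rho nu p q N n : R).

Lemma powR_ge1 (a r : R) : 1 <= a -> 0 <= r -> 1 <= a `^ r.
Proof. by move=> a1 r0; rewrite -(powRr0 a) ler_powR. Qed.

Lemma sqr_powR (a r : R) : 0 <= a -> (a `^ r) ^+ 2 = a `^ (2 * r).
Proof. by move=> a0; rewrite -powR_mulrn ?powR_ge0// -powRrM mulrC. Qed.

(** The first factor comes from the upper bound in (R3); the second pays for replacing [(t * cA)^nu]
    by the effective dimension. *)
Definition decay_const (rho nu bm bp : R) : R :=
  Num.max 1 bp * Num.max 1 (2 / bm ^+ 2) `^ (rho / nu).

Lemma decay_const_ge1 rho nu bm bp : 0 < nu -> 0 < rho ->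
  1 <= decay_const rho nu bm bp.
Proof.
move=> nu0 rho0; rewrite -[leLHS]mulr1; apply: ler_pM => //.
  by rewrite le_max lexx.
by apply: powR_ge1; rewrite ?le_max ?lexx// divr_ge0 ?ltW.
Qed.

(** With [z = (t * cA)^nu], [(t * lam i)^rho] is [(z / (i + 1))^(rho / nu)]. The lower bound in (R3)
    gives [gam j >= bm] for all indices up to [z], so counting them compares [z] with [N]. *)
Lemma filter_decay rho nu cA bm bp (t : R) (lam gam : 'I_D -> R) N :
  0 < nu -> 0 < rho -> 0 < cA -> 0 < bm -> 0 <= t ->
  (forall i, lam i = cA * i.+1%:R `^ (- nu^-1)) ->
  (forall i, bm * Num.min ((t * lam i) `^ rho) 1 <= gam i
             <= Num.min (bp * (t * lam i) `^ rho) 1) ->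
  N = \sum_i gam i ^+ 2 -> 1 <= N ->
  forall i, gam i <= decay_const rho nu bm bp * (N / i.+1%:R) `^ (rho / nu).
Proof.
move=> nu0 rho0 cA0 bm0 t0 lamE hg NE N1 i.
set A := Num.max 1 (2 / bm ^+ 2).
have A1 : 1 <= A by rewrite le_max lexx.
have A2 : 2 / bm ^+ 2 <= A by rewrite le_max lexx orbT.
have p0 : 0 < rho / nu by rewrite divr_gt0.
pose z := (t * cA) `^ nu.
have z0 : 0 <= z by exact: powR_ge0.
have tl j : (t * lam j) `^ rho = (z / j.+1%:R) `^ (rho / nu).
  have jn : (j.+1%:R : R) = j.+1%:R `^ (nu^-1 * nu).
    by rewrite mulVf ?gt_eqF// powRr1.
  rewrite {1}lamE mulrA powRN.
  have -> : z / j.+1%:R = (t * cA / j.+1%:R `^ nu^-1) `^ nu.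
    rewrite [RHS]powRM ?invr_ge0 ?powR_ge0 ?mulr_ge0 ?(ltW cA0)//.
    by rewrite -powRN -powRrM mulNr mulVf ?gt_eqF// powR_inv1.
  by rewrite -powRrM (mulrC nu) divfK ?gt_eqF.
have count k : (k <= D)%N -> k%:R <= z -> bm ^+ 2 * k%:R <= N.
  move=> kD kz; rewrite NE.
  have -> : bm ^+ 2 * k%:R = \sum_(j < D | (j < k)%N) bm ^+ 2.
    rewrite -(big_ord_widen _ (fun=> bm ^+ 2) kD) sumr_const card_ord.
    by rewrite mulr_natr.
  rewrite big_mkcond/=; apply: ler_sum => j _; case: ifP => jk; last exact: sqr_ge0.
  have /andP[+ _] := hg j; rewrite tl min_r ?mulr1; last first.
    apply: powR_ge1; last exact: ltW.
    rewrite ler_pdivlMr ?ltr0n// mul1r.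
    by apply: le_trans kz; rewrite ler_nat.
  by move=> h; rewrite ler_sqr ?nnegrE ?(ltW bm0)// (le_trans (ltW bm0) h).
have n0 : 0 < i.+1%:R :> R by rewrite ltr0n.
have goal2 : (N * A / i.+1%:R) `^ (rho / nu) * Num.max 1 bp <=
  decay_const rho nu bm bp * (N / i.+1%:R) `^ (rho / nu).
  have -> : N * A / i.+1%:R = A * (N / i.+1%:R) by ring.
  have A0 : 0 <= A by lra.
  have Nn0 : 0 <= N / i.+1%:R by rewrite divr_ge0//; lra.
  by rewrite (powRM _ A0 Nn0) mulrC /decay_const -/A mulrA.
apply: le_trans goal2.
have g1 : gam i <= 1.
  by have /andP[_ h] := hg i; apply: le_trans h _; rewrite ge_min lexx orbT.
have M1 : 1 <= Num.max 1 bp by rewrite le_max lexx.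
have bm2 : 0 < bm ^+ 2 by rewrite exprn_gt0.
(* For [i + 1 <= z] the right-hand side is at least 1, because counting the indices up to [i] gives
   [bm ^+ 2 * (i + 1) <= N]. *)
have [nz|zn] := leP i.+1%:R z.
  have hN := count _ (ltn_ord i) nz.
  have ge1 : 1 <= N * A / i.+1%:R.
    rewrite ler_pdivlMr// mul1r.
    apply: (@le_trans _ _ (N * (2 / bm ^+ 2))); last by rewrite ler_pM2l//; lra.
    rewrite mulrA ler_pdivlMr//; lra.
  apply: (le_trans g1); rewrite -[leLHS]mulr1; apply: ler_pM => //.
  by apply: powR_ge1 => //; exact: ltW.
have zN : z <= N * A.
  have [z1|z1] := leP z 1.
    by apply: (le_trans z1); rewrite -[leLHS]mulr1; apply: ler_pM.
  (* For [z > 1] the integer part [k] satisfies [z < k + 1 <= 2 * k], the source of the 2 in [A];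
     [k <= D] because [z] lies below [i + 1]. *)
  have kz := truncn_le z; rewrite z0 in kz. 
  have zk := truncnS_gt z.
  set k := Num.trunc z in kz zk.
  have k1 : (1 <= k)%N by rewrite -ltnS -(ltr_nat R); apply: lt_trans zk.
  have kD : (k <= D)%N.
    apply: leq_trans (ltn_ord i); rewrite -(ler_nat R) ltW//.
    by apply: le_lt_trans zn; exact: le_trans kz _.
  have hN := count _ kD kz.
  have : 1 <= k%:R :> R by rewrite ler1n.
  move: zk; rewrite -natr1 => zk k1'.
  apply: (@le_trans _ _ (N * (2 / bm ^+ 2))); last by rewrite ler_pM2l//; lra.
  rewrite mulrA ler_pdivlMr//; nra.
have /andP[_] := hg i; rewrite tl le_min => /andP[h _].
apply: (le_trans h); apply: (@le_trans _ _ ((z / i.+1%:R) `^ (rho / nu) * Num.max 1 bp)).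
  by rewrite mulrC; apply: ler_wpM2l; rewrite ?powR_ge0// le_max lexx orbT.
apply: ler_wpM2r; first by lra.
have zn0 : 0 <= z / i.+1%:R by rewrite divr_ge0.
have yn0 : 0 <= N * A / i.+1%:R by rewrite !mulr_ge0 ?invr_ge0//; lra.
apply: ge0_ler_powR; rewrite ?nnegrE ?(ltW p0)//.
by apply: ler_wpM2r; rewrite ?invr_ge0 ?(ltW n0).
Qed.
End PolynomialSpectrum.

(** * Trace, variance and bias sums *)

Section FilterSums.
Context (R : realType) (D : nat).
Implicit Types (gam : 'I_D -> R) (B C N p r : R).

Lemma sum_filter_le gam B C N p :
  1 <= B -> 1 <= N ->
  (forall i, gam i <= 1) ->
  (forall i, gam i <= B * (N / i.+1%:R) `^ p) ->
  (\sum_(i < D) i.+1%:R `^ 0 * Num.min 1 ((N / i.+1%:R) `^ p) <= C * N `^ (0 + 1)) ->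
  \sum_i gam i <= B * C * N.
Proof.
move=> B1 N1 g1 gB; rewrite add0r powRr1; last by lra.
move=> hC; rewrite -mulrA; apply: le_trans (_ : B * _ <= _); last first.
  by apply: ler_wpM2l hC; lra.
rewrite mulr_sumr; apply: ler_sum => i _; rewrite powRr0 mul1r.
by rewrite /Num.min; case: ifP => _; rewrite ?mulr1//; apply: le_trans (g1 i) _.
Qed.

Lemma count_le (m : nat) (y : R) : 0 <= y ->
  \sum_(i < m) (i.+1%:R <= y)%R%:R <= Num.min m%:R y.
Proof.
move=> y0; elim: m => [|m IH]; first by rewrite big_ord0 le_min lexx.
rewrite big_ord_recr/=; apply: le_trans (lerD IH (lexx _)) _.
have [hm|hm] := leP m.+1%:R y.
  by rewrite -natr1 lerD2r ge_min lexx.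
by rewrite addr0 ge_min lexx orbT.
Qed.

(** At most [N / 2] indices lie below [N / 2], each with [gam i ^+ 2 <= 1], so at least [N / 2] of
    the mass sits where the weight is at least [(N / 2)^r]. This bounds the variance at [t_s] from
    below. *)
Lemma sum_sqr_mul_powR_ge gam N r : 0 <= r -> (forall i, 0 <= gam i <= 1) ->
  N = \sum_i gam i ^+ 2 ->
  (N / 2) `^ r * (N / 2) <= \sum_i gam i ^+ 2 * i.+1%:R `^ r.
Proof.
move=> r0 g01 NE; have N0 : 0 <= N by rewrite NE sumr_ge0// => i _; exact: sqr_ge0.
have N20 : 0 <= N / 2 by lra.
apply: (@le_trans _ _ (\sum_(i < D) (N / 2) `^ r *
    (gam i ^+ 2 - (i.+1%:R <= N / 2)%R%:R))).
  rewrite -mulr_sumr; apply: ler_wpM2l; first exact: powR_ge0.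
  rewrite sumrB -NE; have := count_le D N20; rewrite le_min => /andP[_]; lra.
apply: ler_sum => i _; have /andP[g0 g1] := g01 i.
have [iN|iN] := leP i.+1%:R (N / 2).
  apply: (@le_trans _ _ 0); last by rewrite mulr_ge0 ?sqr_ge0 ?powR_ge0.
  by rewrite mulr_ge0_le0 ?powR_ge0// subr_le0 expr_le1.
rewrite subr0 mulrC; apply: ler_wpM2l; first exact: sqr_ge0.
by apply: ge0_ler_powR; rewrite ?nnegrE// ltW.
Qed.

(** Index by index: if [gs i <= 1/2], then [(1 - gt i)^2 <= 1 <= 4 (1 - gs i)^2]. Otherwise the
    decay of [gs] forces [i + 1 <= (2 * B)^(1 / p) * N], which bounds [lam i ^- 2]. *)
Lemma sum_bias_le (gt gs mu lam : 'I_D -> R) (cA nu p B N : R) :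
  0 < nu -> 0 < p -> 0 < cA -> 1 <= B -> 1 <= N ->
  (forall i, lam i = cA * i.+1%:R `^ (- nu^-1)) ->
  (forall i, 0 <= gt i <= 1) -> (forall i, 0 <= gs i <= 1) ->
  (forall i, gs i <= B * (N / i.+1%:R) `^ p) ->
  \sum_i (1 - gt i) ^+ 2 * mu i ^+ 2 <=
  cA ^- 2 * ((2 * B) `^ p^-1 * N) `^ (2 / nu) *
    (\sum_i (1 - gt i) ^+ 2 * (lam i * mu i) ^+ 2) +
  4 * \sum_i (1 - gs i) ^+ 2 * mu i ^+ 2.
Proof.
move=> nu0 p0 cA0 B1 N1 lamE gt01 gs01 gsB.
rewrite !mulr_sumr -big_split/=; apply: ler_sum => i _.
have /andP[gt0 gt1] := gt01 i; have /andP[gs0 gs1] := gs01 i.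
have [s2|s2] := leP (gs i) 2^-1.
  apply: ler_wpDl.
    by do 2 apply: mulr_ge0; rewrite ?powR_ge0 ?sqr_ge0 ?invr_ge0 ?sqr_ge0.
  rewrite mulrA; apply: ler_wpM2r; first exact: sqr_ge0.
  nra.
apply: ler_wpDr.
  by apply: mulr_ge0 => //; apply: mulr_ge0; exact: sqr_ge0.
rewrite [leRHS]mulrCA; apply: ler_wpM2l; first exact: sqr_ge0.
rewrite exprMn [leRHS]mulrA; apply: ler_peMl; first exact: sqr_ge0.
set n : R := i.+1%:R; have n0 : 0 < n by rewrite ltr0n.
have nle : n <= (2 * B) `^ p^-1 * N.
  have N0 : 0 < N by lra.
  have h : n `^ p <= 2 * B * N `^ p.
    have := gsB i; rewrite powRM ?invr_ge0 ?(ltW N0) ?(ltW n0)//.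
    rewrite -/n -powR_inv1 ?(ltW n0)// -powRrM mulN1r powRN mulrA => h.
    have np : 0 < n `^ p by rewrite powR_gt0.
    have : 2^-1 <= B * N `^ p / n `^ p by lra.
    rewrite ler_pdivlMr//; lra.
  have -> : n = (n `^ p) `^ p^-1 by rewrite -powRrM divff ?gt_eqF// powRr1// ltW.
  have -> : N = (N `^ p) `^ p^-1 by rewrite -powRrM divff ?gt_eqF// powRr1// ltW.
  rewrite -powRM ?powR_ge0//; last by lra.
  apply: ge0_ler_powR; rewrite ?nnegrE ?invr_ge0 ?(ltW p0) ?powR_ge0//.
  by rewrite mulr_ge0 ?powR_ge0//; lra.
have lam2 : lam i ^+ 2 = cA ^+ 2 * (n `^ (2 / nu))^-1.
  by rewrite lamE exprMn sqr_powR ?(ltW n0)// mulrN powRN.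
rewrite lam2 mulrACA mulVf ?expf_neq0 ?gt_eqF// mul1r ler_pdivlMr ?powR_gt0//.
rewrite mul1r; apply: ge0_ler_powR; rewrite ?nnegrE ?(ltW n0) ?divr_ge0 ?(ltW nu0)//.
by rewrite mulr_ge0 ?powR_ge0//; lra.
Qed.
End FilterSums.

(** * Error decomposition and comparison with the balanced errors *)

Lemma sqr_le_min_powR (R : realType) (g B x p : R) :
  0 <= g <= 1 -> 1 <= B -> 0 <= x -> g <= B * x `^ p ->
  g ^+ 2 <= B ^+ 2 * Num.min 1 (x `^ (2 * p)).
Proof.
move=> /andP[g0 g1] B1 x0 gB; have B0 : 0 <= B := le_trans ler01 B1.
rewrite -sqr_powR// /Num.min; case: ifP => _.
  by rewrite mulr1 ler_sqr ?nnegrE//; exact: le_trans g1 B1.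
by rewrite -exprMn ler_sqr ?nnegrE// mulr_ge0 ?powR_ge0.
Qed.

Lemma estimator_errorE (R : realType) (l m x g dl : R) : 0 < l ->
  g * l^-1 * (l * m + dl * x) - m = (g - 1) * m + g * l^-1 * dl * x.
Proof. by move=> l0; field; rewrite gt_eqF. Qed.

Lemma sqr_error_le (R : realType) (l m x g dl : R) : 0 < l ->
  (g * l^-1 * (l * m + dl * x) - m) ^+ 2 <=
  2 * ((1 - g) ^+ 2 * m ^+ 2) + 2 * dl ^+ 2 * (g ^+ 2 * l ^- 2 * x ^+ 2).
Proof.
move=> l0; rewrite estimator_errorE// -subr_ge0.
have -> : 2 * ((1 - g) ^+ 2 * m ^+ 2) + 2 * dl ^+ 2 * (g ^+ 2 * l ^- 2 * x ^+ 2)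
    - ((g - 1) * m + g * l^-1 * dl * x) ^+ 2 =
    ((g - 1) * m - g * l^-1 * dl * x) ^+ 2.
  by field; rewrite gt_eqF.
exact: sqr_ge0.
Qed.

Lemma weighted_second_moment_ge d (T : measurableType d) (R : realType)
    (P : probability T R) (D : nat) (e : 'I_D -> {RV P >-> R})
    (c b v : 'I_D -> R) :
  (forall i, standard_normal (e i)) -> (forall i, 0 <= c i) ->
  ((\sum_i c i * (b i ^+ 2 + v i ^+ 2) / 8)%:E <=
   \int[P]_w (\sum_i c i * (b i + v i * e i w) ^+ 2)%:E)%E.
Proof.
move=> e_normal c0.
have m2 i : measurable_fun setT (fun w => (b i + v i * e i w) ^+ 2).
  apply: measurable_funX; apply: measurable_funD => //.
  exact: measurable_funM.
under eq_integral do rewrite -sumEFin.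
rewrite ge0_integral_sum//; last 2 first.
- by move=> i; apply/measurable_EFinP; exact: measurable_funM.
- by move=> i w _; rewrite lee_fin mulr_ge0 ?sqr_ge0.
rewrite -sumEFin; apply: lee_sum => i _.
under eq_integral do rewrite EFinM.
rewrite ge0_integralZl ?lee_fin//; last 2 first.
- exact/measurable_EFinP.
- by move=> w _; rewrite lee_fin sqr_ge0.
rewrite -mulrA EFinM; apply: lee_wpmul2l; rewrite ?lee_fin//.
exact: standard_normal_second_moment_ge.
Qed.

(** Used with [x] and [y] the effective dimensions at [t_w] and [t_s], [h = delta^2] and [b] the
    squared strong bias at [t_s]. The mixed term [y^r * x] is at most [x^(r + 1) + y^(r + 1)]; the
    power of [x] is absorbed by the weak entry of the maximum and that of [y], through [v], by the
    strong one. *)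
Lemma oracle_max_bound (R : realType) (r x y h b v K L k : R) :
  0 <= r -> 0 <= x -> 0 <= y -> 0 <= b -> 0 <= h ->
  0 <= K -> 0 <= L -> 0 < k ->
  k * (y / 2) `^ r * (y / 2) <= v ->
  2 * (K * y `^ r * (h * x) + 4 * b) + 2 * h * (L * x `^ (r + 1)) <=
  (2 * K * (8 `^ (r + 1) + 8 * 2 `^ (r + 1) / k) + 64 + 2 * L * 8 `^ (r + 1))
  * Num.max (h * (x / 8) `^ (r + 1)) ((b + h * v) / 8).
Proof.
move=> r0 x0 y0 b0 h0 K0 L0 k0 hv; set M := Num.max _ _.
have q0 : 0 < r + 1 by lra.
have M1 : h * (x / 8) `^ (r + 1) <= M by rewrite le_max lexx.
have M2 : (b + h * v) / 8 <= M by rewrite le_max lexx orbT.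
have powS (z : R) : 0 <= z -> z `^ (r + 1) = z `^ r * z.
  move=> z0; have [->|z1] := eqVneq z 0; first by rewrite mulr0 powR0// gt_eqF.
  by rewrite powRD ?powRr1// (negbTE z1) implybT.
have hx : h * x `^ (r + 1) <= 8 `^ (r + 1) * M.
  have -> : x = 8 * (x / 8) by field.
  rewrite powRM ?divr_ge0// mulrCA; apply: ler_wpM2l M1; exact: powR_ge0.
have v0 : 0 <= v.
  by apply: le_trans hv; rewrite !mulr_ge0 ?powR_ge0 ?divr_ge0 ?(ltW k0).
have hv0 : 0 <= h * v by rewrite mulr_ge0.
have hy : h * y `^ (r + 1) <= 8 * 2 `^ (r + 1) / k * M.
  have hw : h * (y / 2) `^ (r + 1) <= 8 * M / k.
    rewrite ler_pdivlMr// powS ?divr_ge0//.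
    by have := ler_wpM2l h0 hv; lra.
  have -> : 8 * 2 `^ (r + 1) / k * M = 2 `^ (r + 1) * (8 * M / k) by ring.
  have {1}-> : y = 2 * (y / 2) by field.
  rewrite powRM ?divr_ge0// mulrCA; apply: ler_wpM2l hw; exact: powR_ge0.
have hb : b <= 8 * M by lra.
have M0 : 0 <= M by lra.
have hyx : y `^ r * (h * x) <= h * x `^ (r + 1) + h * y `^ (r + 1).
  rewrite mulrCA -mulrDr; apply: ler_wpM2l => //.
  have [xy|yx] := leP x y.
    apply: ler_wpDl; first exact: powR_ge0.
    by rewrite powS//; apply: ler_wpM2l; rewrite ?powR_ge0.
  apply: ler_wpDr; first exact: powR_ge0.
  rewrite (powS x)//; apply: ler_wpM2r => //.
  by apply: ge0_ler_powR; rewrite ?nnegrE ?(ltW yx).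
have H1 : K * (y `^ r * (h * x)) <=
    K * ((8 `^ (r + 1) + 8 * 2 `^ (r + 1) / k) * M).
  by apply: ler_wpM2l => //; rewrite mulrDl; apply: le_trans hyx _; exact: lerD.
have H2 : L * (h * x `^ (r + 1)) <= L * (8 `^ (r + 1) * M) by apply: ler_wpM2l.
rewrite !mulrDl; lra.
Qed.

Lemma integral_affine_le d (T : measurableType d) (R : realType)
    (P : probability T R) (f g : T -> R) (al be c x y : R) :
  measurable_fun setT f -> measurable_fun setT g ->
  (forall w, 0 <= f w) -> (forall w, 0 <= g w) ->
  0 <= al -> 0 <= be -> 0 <= c ->
  (\int[P]_w (f w)%:E <= x%:E)%E -> (\int[P]_w (g w)%:E <= y%:E)%E ->
  (\int[P]_w (al * f w + be * g w + c)%:E <= (al * x + be * y + c)%:E)%E.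
Proof.
move=> mf mg f0 g0 al0 be0 c0 fx gy.
have mEf : measurable_fun setT (fun w => (f w)%:E) by exact/measurable_EFinP.
have mEg : measurable_fun setT (fun w => (g w)%:E) by exact/measurable_EFinP.
have f0' w : setT w -> (0 <= (f w)%:E)%E by rewrite lee_fin.
have g0' w : setT w -> (0 <= (g w)%:E)%E by rewrite lee_fin.
have -> : (\int[P]_w (al * f w + be * g w + c)%:E =
    \int[P]_w (al%:E * (f w)%:E + be%:E * (g w)%:E + cst c%:E w))%E by [].
have al0' w : setT w -> (0 <= al%:E * (f w)%:E)%E.
  by move=> Tw; rewrite mule_ge0 ?lee_fin.
have be0' w : setT w -> (0 <= be%:E * (g w)%:E)%E.
  by move=> Tw; rewrite mule_ge0 ?lee_fin.
have maf := measurable_funeM al%:E mEf; have mbg := measurable_funeM be%:E mEg.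
rewrite ge0_integralD//; last 2 first.
- by move=> w Tw; rewrite adde_ge0 ?al0' ?be0'.
- exact: emeasurable_funD.
rewrite ge0_integralD// !ge0_integralZl ?lee_fin// integral_cst//=.
rewrite probability_setT mule1 !EFinD !EFinM.
by apply: leeD => //; apply: leeD; apply: lee_wpmul2l; rewrite ?lee_fin.
Qed.

(** * Assembly of the oracle inequality with explicit constants *)

Theorem corollary3p6 (R : realType)
    (rho beta_m beta_p c_A Ccirc Ckappa nu : R)
    (hrho : 1 < rho) (hbm : 0 < beta_m) (hbp : 0 < beta_p) (hcA : 0 < c_A)
    (hCcirc : 1 <= Ccirc) (hCkappa : 0 <= Ckappa < Ccirc)
    (hnu : 0 < nu < Num.min rho (2 * rho - 2)) :
  exists C : R,
  forall (D : nat) (delta kappa : R) (lam mu : 'I_D -> R) (g : R -> R -> R)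
    (d : measure_display) (T : measurableType d) (P : probability T R)
    (eps : 'I_D -> {RV P >-> R}),
  let gamma := regulariser_filter g lam in
  let Y := fun w : T => observation lam mu delta (fun i => eps i w) in
  let t_circ := initial_time gamma delta Ccirc in
  let tau := fun w : T => stopping_time gamma (Y w) kappa t_circ in
  let t_w := weak_balanced_time lam gamma mu delta t_circ in
  let t_s := strong_balanced_time lam gamma mu delta t_circ in
  let err := fun (t : R) (w : T) (i : 'I_D) =>
    estimator lam gamma (Y w) t i - mu i in
  0 < delta ->
  spectrum lam ->
  (forall i : 'I_D, lam i = c_A * i.+1%:R `^ (- nu^-1)) ->
  mutually_independent eps ->
  (forall i : 'I_D, standard_normal (eps i)) ->
  Ccirc < Num.sqrt D%:R ->
  assumption_R g t_circ rho beta_m beta_p ->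
  0 < kappa ->
  `|kappa - D%:R * delta ^+ 2| <= Ckappa * Num.sqrt D%:R * delta ^+ 2 ->
  ('E_P[fun w => strong_sqnorm (err (tau w) w)] <=
   C%:E * maxe
     ((delta `^ (- (4 / nu)))%:E *
        'E_P[fun w => weak_sqnorm lam (err t_w w)] `^ (1 + 2 / nu))
     'E_P[fun w => strong_sqnorm (err t_s w)])%E.
Proof.
have combine (X S m1 m2 w1 w2 b al be : R) :
    X <= 2 * m1 + be * S -> m1 <= al * m2 + 4 * b -> be * S <= be * w2 ->
    al * m2 <= al * w1 -> X <= 2 * al * w1 + be * w2 + 8 * b by lra.
have [rho0 nu0] : 0 < rho /\ 0 < nu by case/andP: hnu => ? _; split; lra.
have /andP[_] := hnu; rewrite lt_min => /andP[nu_rho nu_2rho].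
have p1 : 0 + 1 < rho / nu by rewrite add0r ltr_pdivlMr// mul1r.
have p2 : 2 / nu + 1 < 2 * (rho / nu).
  rewrite -subr_gt0; have -> : 2 * (rho / nu) - (2 / nu + 1) = (2 * rho - 2 - nu) / nu.
    by field; rewrite gt_eqF.
  by rewrite divr_gt0//; lra.
have r0 : 0 <= 2 / nu by rewrite divr_ge0// ltW.
(* [p1] and [p2] are the conditions [nu < rho] and [nu < 2 * rho - 2]. [S1] serves the trace of the
   filter, [S2] the variance sum. *)
have [S1 S10 hS1] := sum_powR_min_le (lexx (0 : R)) p1.
have [S2 S20 hS2] := sum_powR_min_le r0 p2.
have /andP[Ck0 CkC] := hCkappa.
pose B := decay_const rho nu beta_m beta_p.
have B1 : 1 <= B by exact: decay_const_ge1.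
pose r := 2 / nu; pose C1 := B * S1.
have C10 : 0 <= C1 by rewrite mulr_ge0//; lra.
pose A2 := B ^+ 2 * c_A ^- 2 * S2.
have A20 : 0 <= A2.
  apply: mulr_ge0 => //; apply: mulr_ge0; first exact: sqr_ge0.
  by rewrite invr_ge0 sqr_ge0.
(* [K1] belongs to the stopped weak bias, [K2] to the stopped noise, and [K3] is the price of
   passing from the weak to the strong bias. *)
pose K1 := layer_const 1 * (6 * (2 * C1 + 4 + Ckappa)).
pose K2 := layer_const (r + 1) * A2 * (8 * (Ckappa + 3)) `^ (r + 1).
pose K3 := c_A ^- 2 * ((2 * B) `^ (rho / nu)^-1) `^ r.
have Ck3 : 0 <= 8 * (Ckappa + 3) by rewrite mulr_ge0 ?addr_ge0.
have K10 : 0 <= K1 by apply: mulr_ge0; [exact: layer_const_ge0|lra].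
have K20 : 0 <= K2.
  apply: mulr_ge0; last exact: powR_ge0.
  by apply: mulr_ge0 => //; apply: layer_const_ge0; rewrite addr_ge0.
have K30 : 0 <= K3 by rewrite mulr_ge0 ?powR_ge0// invr_ge0 sqr_ge0.
pose k := c_A ^- 2.
have k0 : 0 < k by rewrite invr_gt0 exprn_gt0.
pose C := 2 * (K3 * K1) * (8 `^ (r + 1) + 8 * 2 `^ (r + 1) / k) + 64
  + 2 * K2 * 8 `^ (r + 1).
have C0 : 0 <= C.
  apply: addr_ge0; last by apply: mulr_ge0; [exact: mulr_ge0|exact: powR_ge0].
  apply: addr_ge0 => //; apply: mulr_ge0.
    by apply: mulr_ge0 => //; exact: mulr_ge0.
  apply: addr_ge0; first exact: powR_ge0.
  by rewrite divr_ge0 ?(ltW k0)// mulr_ge0 ?powR_ge0.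
exists C => D delta kappa lam mu g d T P eps gamma Y t_circ tau t_w t_s err.
move=> delta0 [lam1 _ lam0] lamE eps_indep eps_normal hD hR kappa0 hkappa.
have delta2 : 0 < delta ^+ 2 by rewrite exprn_gt0.
have D1 : 1 <= D%:R :> R.
  rewrite ler1n lt0n; apply: contraTneq hD => ->.
  by rewrite sqrtr0 -leNgt; lra.
have gamma01 t i : 0 <= t -> 0 <= gamma t i <= 1.
  by move=> t0; apply: (reg_range hR) => //; exact/ltW/lam0.
have gamma_nd s t i : 0 <= s -> s <= t -> gamma s i <= gamma t i.
  by move=> s0 st; apply: (reg_mono_time hR) => //; exact/ltW/lam0.
have gamma_cont i : {within [set t | 0 <= t], continuous (gamma ^~ i)}.
  exact: (reg_continuous hR).
have gamma_lim i : (gamma ^~ i) t @[t --> +oo] --> (1 : R).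
  exact: (reg_limit hR).
(* The observation is [delta * (a i + eps i)], so the weak quantities are [delta ^+ 2] times
   functionals of [a], of [obs] or of the filter alone, and [kap] is the threshold in the same
   units. *)
pose a i := lam i * mu i / delta.
pose obs w i := a i + eps i w.
pose kap := kappa / delta ^+ 2.
have kap0 : 0 < kap by rewrite divr_gt0.
have kap_near : `|kap - D%:R| <= Ckappa * Num.sqrt D%:R.
  have -> : kap - D%:R = (kappa - D%:R * delta ^+ 2) / delta ^+ 2.
    by rewrite /kap; field; rewrite gt_eqF.
  by rewrite normrM normfV (gtr0_norm delta2) ler_pdivrMr.
have wvarE t : weak_variance gamma delta t = delta ^+ 2 * effdim gamma t by [].
have wbiasE t : weak_bias_sq lam gamma mu t = delta ^+ 2 * wres gamma a t.
  rewrite /weak_bias_sq /wres mulr_sumr; apply: eq_bigr => i _.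
  by rewrite /a; field; rewrite gt_eqF.
have resE w t : residual_sq gamma (Y w) t = delta ^+ 2 * wres gamma (obs w) t.
  rewrite /residual_sq /wres mulr_sumr; apply: eq_bigr => i _.
  by rewrite /Y /observation /obs /a; field; rewrite gt_eqF.
have sbiasE t : strong_bias_sq gamma mu t = wres gamma mu t by [].
have gamma0 i : gamma 0 i = 0 by exact: (reg_at0 hR).
have sD1 : 1 <= Num.sqrt D%:R :> R by rewrite -[leLHS]sqrtr1 ler_sqrt.
have Cc0 : 0 <= Ccirc := le_trans ler01 hCcirc.
have sD0 : 0 < Num.sqrt D%:R :> R := lt_le_trans ltr01 sD1.
have CsD0 : 0 <= Ccirc * Num.sqrt D%:R := mulr_ge0 Cc0 (ltW sD0).
have cD : Ccirc * Num.sqrt D%:R < D%:R.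
  by rewrite -[ltRHS](@sqr_sqrtr _ D%:R)// expr2 ltr_pM2r.
have t_circE : t_circ =
    inf [set t | 0 <= t /\ effdim gamma t = Ccirc * Num.sqrt D%:R].
  congr inf; apply: eq_set => t; rewrite wvarE mulrC; congr (_ /\ _).
  by apply/propext; split=> [/mulIf->//|->//]; rewrite gt_eqF.
have [t00 NtC] := inf_effdim_eq gamma01 gamma_nd gamma_cont gamma_lim CsD0 cD gamma0.
rewrite -t_circE in t00 NtC.
have Nt0 : Num.sqrt D%:R <= effdim gamma t_circ.
  by apply: le_trans NtC; rewrite ler_peMl// ltW.
have Nge t : t_circ <= t -> Num.sqrt D%:R <= effdim gamma t.
  by move=> ht; apply: (le_trans Nt0); exact: effdim_nd.
have Nge1 t : t_circ <= t -> 1 <= effdim gamma t.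
  by move=> /Nge; exact: le_trans.
have tauE w : tau w =
    inf [set t | t_circ <= t /\ wres gamma (obs w) t <= kap].
  by congr inf; apply: eq_set => t; rewrite resE -ler_pdivlMl// mulrC.
have tau_ge w : t_circ <= tau w.
  by rewrite tauE; have [] :=
    inf_wres_le gamma01 gamma_nd gamma_cont gamma_lim (obs w) t00 kap0.
have tau_stop w : wres gamma (obs w) (tau w) <= kap.
  by rewrite tauE; have [] :=
    inf_wres_le gamma01 gamma_nd gamma_cont gamma_lim (obs w) t00 kap0.
have tau_min w t : t_circ <= t -> t < tau w -> kap < wres gamma (obs w) t.
  by rewrite tauE; have [_ _] :=
    inf_wres_le gamma01 gamma_nd gamma_cont gamma_lim (obs w) t00 kap0; exact.
have t_wE : t_w =
    inf [set t | t_circ <= t /\ wres gamma a t <= effdim gamma t].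
  by congr inf; apply: eq_set => t; rewrite wbiasE wvarE ler_pM2l.
have [tw_ge tw_bal] : t_circ <= t_w /\ wres gamma a t_w <= effdim gamma t_w.
  rewrite t_wE; apply: inf_wres_le_effdim => //; exact: Nge1.
(* The set defining [t_s] is nonempty: the strong bias falls below [delta ^+ 2], while the variance
   is at least [delta ^+ 2] because [lam i <= 1] and the effective dimension is at least 1. *)
have ts_ge : t_circ <= t_s.
  apply: lb_le_inf; last by move=> t [].
  have [t tt ht] := wres_lim gamma_lim mu t_circ delta2.
  exists t; split => //; rewrite sbiasE; apply: (le_trans (ltW ht)).
  rewrite /strong_variance ler_peMr//; first exact: ltW.
  apply: le_trans (Nge1 _ tt) _; apply: ler_sum => i _.
  rewrite ler_peMr ?sqr_ge0// -exprVn; apply: exprn_ege1.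
  by rewrite invf_ge1.
have decay t : t_circ <= t -> forall i,
    gamma t i <= B * (effdim gamma t / i.+1%:R) `^ (rho / nu).
  move=> ht; apply: (@filter_decay _ _ rho nu c_A beta_m beta_p t lam) => //.
  - exact: le_trans ht.
  - by move=> i; apply: (reg_bounds hR) => //; rewrite lam0 lam1.
  - exact: Nge1.
pose Nw := effdim gamma t_w; pose Ns := effdim gamma t_s.
have Nw1 : 1 <= Nw := Nge1 _ tw_ge.
have Ns1 : 1 <= Ns := Nge1 _ ts_ge.
have tw0 := le_trans t00 tw_ge; have ts0 := le_trans t00 ts_ge.
have trace_w : \sum_i gamma t_w i <= C1 * effdim gamma t_w.
  apply: (@sum_filter_le _ _ _ B S1 Nw (rho / nu)) => //.
  - by move=> i; have /andP[] := gamma01 _ i tw0.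
  - exact: decay.
  - exact: hS1.
have [W1 [mW1 W1ge W1int]] := weak_bias_stopped_majorant gamma01 gamma_nd
  gamma_cont gamma_lim eps_indep eps_normal t00 tw_ge Ck0 D1 kap_near tw_bal
  (Nge _ tw_ge) trace_w tau_ge tau_stop C10.
have sqrB t i : t_circ <= t -> gamma t i ^+ 2 <=
    B ^+ 2 * Num.min 1 ((effdim gamma t / i.+1%:R) `^ (2 * (rho / nu))).
  move=> ht; apply: sqr_le_min_powR => //.
  - exact/gamma01/(le_trans t00 ht).
  - by rewrite divr_ge0// (le_trans ler01)// Nge1.
  - exact: decay.
(* The coefficients combine the squared filter decay, with [u] in place of the effective dimension,
   and the exact value of [lam i ^- 2]; by [hS2] their sum is at most [A2 * u^(r + 1)]. *)
have := @noise_stopped_majorant _ _ gamma gamma01 gamma_nd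
  gamma_cont gamma_lim _ _ _ _ eps_indep eps_normal a kap Ckappa t_circ t_w tau
  t00 tw_ge Ck0 D1 kap_near tw_bal (Nge _ tw_ge) tau_ge tau_min (r + 1) A2
  (fun i => lam i ^- 2)
  (fun u i => B ^+ 2 * Num.min 1 ((u / i.+1%:R) `^ (2 * (rho / nu))) *
     (c_A ^- 2 * i.+1%:R `^ r)).
have lam2 i : lam i ^- 2 = c_A ^- 2 * i.+1%:R `^ r.
  by rewrite lamE exprMn sqr_powR// mulrN powRN invfM invrK.
case.
- by rewrite addr_ge0.
- by [].
- by move=> i; rewrite invr_ge0 sqr_ge0.
- move=> u i; do 2 apply: mulr_ge0; rewrite ?sqr_ge0 ?invr_ge0 ?sqr_ge0 ?powR_ge0//.
  by rewrite le_min ler01 powR_ge0.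
- move=> u u1; have := hS2 u D u1.
  have BcA : 0 <= B ^+ 2 * c_A ^- 2.
    by rewrite mulr_ge0 ?sqr_ge0// invr_ge0 sqr_ge0.
  move=> /(ler_wpM2l BcA); rewrite [X in _ <= X]mulrA -/A2 => /(le_trans _); apply.
  by rewrite mulr_sumr; apply: ler_sum => i _; rewrite le_eqVlt; apply/orP; left;
    apply/eqP; rewrite /r; ring.
- move=> u t i ht Ntu; rewrite lam2; apply: ler_wpM2r.
    by rewrite mulr_ge0 ?powR_ge0// invr_ge0 sqr_ge0.
  apply: (le_trans (sqrB t i ht)); apply: ler_wpM2l; first exact: sqr_ge0.
  rewrite le_min ge_min lexx/= ge_min; apply/orP; right.
  have N0t : 0 <= effdim gamma t := le_trans ler01 (Nge1 _ ht).
  have p0 : 0 <= 2 * (rho / nu) by rewrite mulr_ge0// divr_ge0// ltW.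
  apply: ge0_ler_powR; rewrite ?nnegrE ?divr_ge0//; first exact: le_trans Ntu.
  by rewrite ler_wpM2r ?invr_ge0.
move=> W2 [mW2 W2ge W2int].
have kv : k * (Ns / 2) `^ r * (Ns / 2) <= \sum_i gamma t_s i ^+ 2 * lam i ^- 2.
  have := @sum_sqr_mul_powR_ge _ _ (gamma t_s) Ns r r0 (fun i => gamma01 _ i ts0) erefl.
  move=> /(ler_wpM2l (ltW k0)) h; rewrite -mulrA; apply: le_trans h _.
  rewrite mulr_sumr; apply: ler_sum => i _; rewrite lam2 /k.
  by rewrite le_eqVlt; apply/orP; left; apply/eqP; ring.
set v := \sum_i gamma t_s i ^+ 2 * lam i ^- 2 in kv.
pose bs := strong_bias_sq gamma mu t_s.
have bs0 : 0 <= bs by rewrite /bs sbiasE; exact: wres_ge0.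
have d0 : 0 <= 2 * delta ^+ 2 by rewrite mulr_ge0 ?sqr_ge0.
have Nw0 : 0 <= Nw := le_trans ler01 Nw1.
have Ns0 : 0 <= Ns := le_trans ler01 Ns1.
have upper : ('E_P[fun w => strong_sqnorm (err (tau w) w)] <=
    (2 * (K3 * K1 * Ns `^ r * (delta ^+ 2 * Nw) + 4 * bs)
     + 2 * delta ^+ 2 * (K2 * Nw `^ (r + 1)))%:E)%E.
  rewrite unlock; pose al := 2 * (K3 * Ns `^ r * delta ^+ 2).
  (* For each outcome [sqr_error_le] separates bias and noise, [sum_bias_le] trades the strong bias
     for the weak one, and [W1], [W2] majorise the two random terms. *)
  have path w : strong_sqnorm (err (tau w) w) <=
      al * W1 w + 2 * delta ^+ 2 * W2 w + 8 * bs.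
    have tau0 := le_trans t00 (tau_ge w).
    have hsq : strong_sqnorm (err (tau w) w) <=
        2 * wres gamma mu (tau w) + 2 * delta ^+ 2 *
          \sum_i gamma (tau w) i ^+ 2 * lam i ^- 2 * eps i w ^+ 2.
      rewrite /wres !mulr_sumr -big_split/=; apply: ler_sum => i _.
      exact: sqr_error_le.
    have := @sum_bias_le _ _ (gamma (tau w)) (gamma t_s) mu lam c_A nu (rho / nu) B
      Ns nu0 (divr_gt0 rho0 nu0) hcA B1 Ns1 lamE (fun i => gamma01 _ i tau0)
      (fun i => gamma01 _ i ts0) (decay _ ts_ge).
    have -> : \sum_i (1 - gamma (tau w) i) ^+ 2 * (lam i * mu i) ^+ 2 =
        delta ^+ 2 * wres gamma a (tau w).
      by rewrite -wbiasE; apply: eq_bigr => i _; rewrite exprMn mulrA.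
    have -> : c_A ^- 2 * ((2 * B) `^ (rho / nu)^-1 * Ns) `^ (2 / nu) = K3 * Ns `^ r.
      by rewrite (powRM _ (powR_ge0 _ _) Ns0) mulrA.
    rewrite -/(wres gamma mu (tau w)) -/(strong_bias_sq gamma mu t_s) -/bs => hb.
    have h2 := ler_wpM2l d0 (W2ge w).
    have al0 : 0 <= K3 * Ns `^ r * delta ^+ 2.
      by rewrite mulr_ge0 ?sqr_ge0// mulr_ge0 ?powR_ge0.
    have h1 := ler_wpM2l al0 (W1ge w).
    rewrite mulrA in hb; exact: (combine _ _ _ _ _ _ _ _ _ hsq hb h2 h1).
  apply: (@le_trans _ _ (\int[P]_w (al * W1 w + 2 * delta ^+ 2 * W2 w + 8 * bs)%:E)%E).
    apply: ge0_le_integral_nonmeasurable => w; rewrite lee_fin//.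
    by apply: sumr_ge0 => i _; exact: sqr_ge0.
  have := @integral_affine_le _ _ _ P W1 W2 al (2 * delta ^+ 2) (8 * bs)
    (K1 * Nw) (K2 * Nw `^ (r + 1)) mW1 mW2.
  move=> h; apply: le_trans (h _ _ _ _ _ _ _) _.
  - by move=> w; apply: le_trans (W1ge w); exact: wres_ge0.
  - move=> w; apply: le_trans (W2ge w); apply: sumr_ge0 => i _.
    rewrite mulr_ge0 ?sqr_ge0// mulr_ge0 ?sqr_ge0// invr_ge0.
    exact: sqr_ge0.
  - by rewrite /al mulr_ge0// mulr_ge0 ?sqr_ge0// mulr_ge0 ?powR_ge0.
  - exact: d0.
  - exact: mulr_ge0.
  - exact: W1int.
  - by move: W2int; rewrite (powRM _ Ck3 Nw0) mulrA.
  - by rewrite lee_fin /al le_eqVlt; apply/orP; left; apply/eqP; ring.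
(* At [t_w] only the noise part of the error is kept; [lower_s] keeps both bias and variance. *)
have lower_w : ((delta ^+ 2 * (Nw / 8))%:E <=
    'E_P[fun w => weak_sqnorm lam (err t_w w)])%E.
  rewrite unlock; have := weighted_second_moment_ge
    (fun i => (gamma t_w i - 1) * mu i) (fun i => gamma t_w i * (lam i)^-1 * delta)
    eps_normal (fun i => sqr_ge0 (lam i)).
  rewrite [X in (_ <= X)%E -> _](_ : _ =
     \int[P]_w (weak_sqnorm lam (err t_w w))%:E)%E; last first.
    apply: eq_integral => w _; congr EFin; apply: eq_bigr => i _; congr (_ * _ ^+ 2).
    by rewrite /err /estimator /Y /observation estimator_errorE.
  apply: le_trans; rewrite lee_fin /Nw /effdim mulr_suml mulr_sumr.
  apply: ler_sum => i _.
  have -> : delta ^+ 2 * (gamma t_w i ^+ 2 / 8) =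
      lam i ^+ 2 * (gamma t_w i * (lam i)^-1 * delta) ^+ 2 / 8.
    by field; rewrite gt_eqF.
  rewrite ler_pM2r ?invr_gt0// ler_wpM2l ?sqr_ge0// lerDr.
  exact: sqr_ge0.
have lower_s : (((bs + delta ^+ 2 * v) / 8)%:E <=
    'E_P[fun w => strong_sqnorm (err t_s w)])%E.
  rewrite unlock; have := weighted_second_moment_ge
    (fun i => (gamma t_s i - 1) * mu i) (fun i => gamma t_s i * (lam i)^-1 * delta)
    eps_normal (fun i => ler01).
  rewrite [X in (_ <= X)%E -> _](_ : _ =
     \int[P]_w (strong_sqnorm (err t_s w))%:E)%E; last first.
    apply: eq_integral => w _; congr EFin; apply: eq_bigr => i _; rewrite mul1r.
    by rewrite /err /estimator /Y /observation estimator_errorE.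
  apply: le_trans; rewrite lee_fin /bs /strong_bias_sq /v mulr_sumr -big_split/=.
  rewrite mulr_suml; apply: ler_sum => i _; rewrite le_eqVlt; apply/orP; left.
  by apply/eqP; field; rewrite gt_eqF.
apply: (le_trans upper).
have := @oracle_max_bound _ r Nw Ns (delta ^+ 2) bs v (K3 * K1) K2 k r0 Nw0 Ns0 bs0
  (ltW delta2) (mulr_ge0 K30 K10) K20 k0 kv.
rewrite -lee_fin => /le_trans; apply.
rewrite EFinM; apply: lee_wpmul2l; first by rewrite lee_fin.
rewrite EFin_max ge_max !le_max; apply/andP; split; apply/orP; [left|right] => //.
(* The power contributes [delta^(2 + 4 / nu)], which the prefactor reduces to [delta ^+ 2]. *)
have powE : delta `^ (- (4 / nu)) * (delta ^+ 2 * (Nw / 8)) `^ (1 + 2 / nu) =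
    delta ^+ 2 * (Nw / 8) `^ (r + 1).
  rewrite powRM ?sqr_ge0 ?divr_ge0// mulrA -[delta ^+ 2 in LHS]powR_mulrn ?ltW//.
  rewrite -powRrM -powRD ?(gt_eqF delta0) ?implybT//.
  rewrite -[delta ^+ 2 in RHS]powR_mulrn ?(ltW delta0)//.
  by congr (_ `^ _ * _ `^ _); rewrite /r; [field; rewrite gt_eqF|ring].
rewrite -powE EFinM; apply: lee_wpmul2l; first by rewrite lee_fin powR_ge0.
rewrite -[X in (X <= _)%E]poweR_EFin.
have r1 : 0 <= 1 + 2 / nu by rewrite addr_ge0.
have x0 : (0 <= (delta ^+ 2 * (Nw / 8))%:E)%E.
  by rewrite lee_fin mulr_ge0 ?sqr_ge0// divr_ge0.
apply: (gt0_ler_poweR r1 _ _ lower_w); rewrite in_itv/= leey andbT//.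
exact: le_trans x0 lower_w.
Qed.
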